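(* Let $S,S'\subseteq\mathbb{N}_{>100}$ be subsets whose symmetric difference $S\Delta S'=(S-S')\cup(S'-S)$ is infinite. Then the finitely generated groups $G(S)=\langle a,b\mid w_n\colon n\in S\rangle$ and $G(S')=\langle a,b\mid w_n\colon n\in S'\rangle$ are not quasi-isometric.
   Context: $\mathbb{N}_{>100}=\{n\in\mathbb{N}\colon n>100\}$. For $n\in\mathbb{N}$, $w_n$ is the word in the free group $F_2=\langle a,b\rangle$ given by $w_n=[a,b^{2^{2^n}}][a^2,b^{2^{2^n}}]\cdots[a^{100},b^{2^{2^n}}]$, i.e. the product over $i=1,\dots,100$, in this order, of the commutators $[a^i,b^{2^{2^n}}]$, where $[x,y]=xyx^{-1}y^{-1}$. Finitely generated groups are regarded as metric spaces via word metrics with respect to finite generating sets. *)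

(* Defs.v *)
From HB Require Import structures.
From mathcomp Require Import all_boot all_order all_algebra.
From mathcomp Require Import boolp classical_sets cardinality reals.

Set Implicit Arguments.
Unset Strict Implicit.
Unset Printing Implicit Defensive.

Local Open Scope quotient_scope.
Local Open Scope classical_set_scope.
Local Open Scope group_scope.

Section FreeGroup.
Variable X : choiceType.

(* The letter (x, false) stands for x, and (x, true) for its inverse. *)
Definition fword := seq (X * bool).

Inductive free_eq : fword -> fword -> Prop :=
| free_eq_refl s : free_eq s s
| free_eq_sym s t : free_eq s t -> free_eq t s
| free_eq_trans s t u : free_eq s t -> free_eq t u -> free_eq s u
| free_eq_cancel s t x b :
    free_eq (s ++ (x, b) :: (x, ~~ b) :: t) (s ++ t).

Definition free_eqb : rel fword := fun s t => `[< free_eq s t >].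

Lemma free_eqb_refl : reflexive free_eqb.
Proof. by move=> s; apply/asboolP; exact: free_eq_refl. Qed.

Lemma free_eqb_sym : symmetric free_eqb.
Proof. by move=> s t; apply/asboolP/asboolP; exact: free_eq_sym. Qed.

Lemma free_eqb_trans : transitive free_eqb.
Proof.
move=> t s u /asboolP st /asboolP tu; apply/asboolP.
exact: free_eq_trans st tu.
Qed.

Canonical free_equiv := EquivRel free_eqb free_eqb_refl free_eqb_sym free_eqb_trans.

Definition free_group := {eq_quot free_equiv}.
HB.instance Definition _ := Choice.on free_group.
HB.instance Definition _ := EqQuotient.on free_group.

Lemma free_piP (s t : fword) :
  reflect (free_eq s t) (\pi_free_group s == \pi_free_group t).
Proof. by rewrite eqmodE; exact: asboolP. Qed.

Lemma free_eq_cat s s' t t' :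
  free_eq s s' -> free_eq t t' -> free_eq (s ++ t) (s' ++ t').
Proof.
move=> ss' tt'; apply: (free_eq_trans (t := s' ++ t)).
  elim: ss' => [u|u v _|u v w _ uv _|u v x b]; first exact: free_eq_refl.
  - exact: free_eq_sym.
  - exact: free_eq_trans.
  - by rewrite -!catA; exact: free_eq_cancel.
elim: tt' => [u|u v _|u v w _ uv _|u v x b]; first exact: free_eq_refl.
- exact: free_eq_sym.
- exact: free_eq_trans.
- by rewrite !catA; exact: free_eq_cancel.
Qed.

Definition winv (s : fword) : fword := [seq (p.1, ~~ p.2) | p <- rev s].

Lemma winv_cat s t : winv (s ++ t) = winv t ++ winv s.
Proof. by rewrite /winv rev_cat map_cat. Qed.

Lemma winv_cons p s : winv (p :: s) = winv s ++ [:: (p.1, ~~ p.2)].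
Proof. by rewrite -cat1s winv_cat. Qed.

Lemma free_eq_winv s t : free_eq s t -> free_eq (winv s) (winv t).
Proof.
elim=> [u|u v _|u v w _ uv _|u v x b]; first exact: free_eq_refl.
- exact: free_eq_sym.
- exact: free_eq_trans.
- by rewrite !winv_cat !winv_cons /= negbK -!catA; exact: free_eq_cancel.
Qed.

Lemma free_eq_winvl s : free_eq (winv s ++ s) [::].
Proof.
elim: s => [|[x b] s IH]; first exact: free_eq_refl.
rewrite winv_cons -catA /=.
by have := free_eq_cancel (winv s) s x (~~ b); rewrite negbK => /free_eq_trans; exact.
Qed.

Definition fg_one : free_group := \pi_free_group [::].
Definition fg_mul (g h : free_group) : free_group :=
  \pi_free_group (repr g ++ repr h).
Definition fg_inv (g : free_group) : free_group := \pi_free_group (winv (repr g)).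

Lemma repr_pi_free s : free_eq (repr (\pi_free_group s)) s.
Proof. by apply/free_piP; rewrite reprK. Qed.

Lemma fg_mul_pi s t :
  fg_mul (\pi_free_group s) (\pi_free_group t) = \pi_free_group (s ++ t).
Proof. by apply/eqP/free_piP; apply: free_eq_cat; exact: repr_pi_free. Qed.

Lemma fg_inv_pi s : fg_inv (\pi_free_group s) = \pi_free_group (winv s).
Proof. by apply/eqP/free_piP; apply: free_eq_winv; exact: repr_pi_free. Qed.

Lemma fg_mulA : associative fg_mul.
Proof.
elim/quotW=> s; elim/quotW=> t; elim/quotW=> u.
by rewrite (fg_mul_pi t u) (fg_mul_pi s t) !fg_mul_pi catA.
Qed.

Lemma fg_mul1 : left_id fg_one fg_mul.
Proof. by elim/quotW=> g; rewrite fg_mul_pi. Qed.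

Lemma fg_mulr1 : right_id fg_one fg_mul.
Proof. by elim/quotW=> g; rewrite fg_mul_pi cats0. Qed.

Lemma fg_mulV : left_inverse fg_one fg_inv fg_mul.
Proof.
elim/quotW=> g; rewrite fg_inv_pi fg_mul_pi.
by apply/eqP/free_piP; exact: free_eq_winvl.
Qed.

Lemma fg_mulrV : right_inverse fg_one fg_inv fg_mul.
Proof.
elim/quotW=> g; rewrite fg_inv_pi fg_mul_pi.
apply/eqP/free_piP; have := free_eq_winvl (winv g).
rewrite {1}/winv -map_rev revK -map_comp map_id_in // => -[x b] _ /=.
by rewrite negbK.
Qed.

HB.instance Definition _ := isGroup.Build free_group
  fg_mulA fg_mul1 fg_mulr1 fg_mulV fg_mulrV.

Definition free_gen (x : X) : free_group := \pi_free_group [:: (x, false)].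

End FreeGroup.

Section Quotient.
Variable G : groupType.

Record normal_subgroup (N : set G) : Prop := NormalSubgroup {
  normal1 : N 1;
  normalM : forall x y, N x -> N y -> N (x * y);
  normalV : forall x, N x -> N x^-1;
  normalJ : forall x y, N x -> N (x ^ y)
}.

Definition normal_closure (R : set G) : set G :=
  \bigcap_(N in [set N | normal_subgroup N /\ R `<=` N]) N.

Lemma normal_closureP (R : set G) : normal_subgroup (normal_closure R).
Proof.
split=> [N [hN _]|x y hx hy N hN|x hx N hN|x y hx N hN].
- exact: normal1.
- by apply: (normalM hN.1); [exact: hx|exact: hy].
- by apply: (normalV hN.1); exact: hx.
- by apply: (normalJ hN.1); exact: hx.
Qed.

Variables (N : set G) (hN : normal_subgroup N).

Definition coset_eqb : rel G := fun g h => `[< N (g^-1 * h) >].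

Lemma coset_eqb_refl : reflexive coset_eqb.
Proof. by move=> g; apply/asboolP; rewrite mulVg; exact: normal1. Qed.

Lemma coset_eqb_sym : symmetric coset_eqb.
Proof.
by move=> g h; apply/asboolP/asboolP => /(normalV hN); rewrite invgM invgK.
Qed.

Lemma coset_eqb_trans : transitive coset_eqb.
Proof.
move=> h g k /asboolP gh /asboolP hk; apply/asboolP.
by have := normalM hN gh hk; rewrite -mulgA mulVKg.
Qed.

Definition coset_equiv :=
  EquivRel coset_eqb coset_eqb_refl coset_eqb_sym coset_eqb_trans.

Definition quotient_group := {eq_quot coset_equiv}.
HB.instance Definition _ := Choice.on quotient_group.
HB.instance Definition _ := EqQuotient.on quotient_group.

Lemma quotient_piP (g h : G) :
  reflect (N (g^-1 * h)) (\pi_quotient_group g == \pi_quotient_group h).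
Proof. by rewrite eqmodE; exact: asboolP. Qed.

Definition qg_one : quotient_group := \pi_quotient_group 1.
Definition qg_mul (g h : quotient_group) : quotient_group :=
  \pi_quotient_group (repr g * repr h).
Definition qg_inv (g : quotient_group) : quotient_group :=
  \pi_quotient_group (repr g)^-1.

Lemma repr_pi_quotient g : N ((repr (\pi_quotient_group g))^-1 * g).
Proof. by apply/quotient_piP; rewrite reprK. Qed.

Lemma qg_mul_pi g h :
  qg_mul (\pi_quotient_group g) (\pi_quotient_group h) = \pi_quotient_group (g * h).
Proof.
apply/eqP/quotient_piP.
have := repr_pi_quotient g; have := repr_pi_quotient h.
set h' := repr (\pi h); set g' := repr (\pi g) => hh gg.
have -> : (g' * h')^-1 * (g * h) = (g'^-1 * g) ^ h' * (h'^-1 * h).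
  by rewrite conjgE invgM -!mulgA mulVKg.
by apply: (normalM hN) => //; exact: normalJ.
Qed.

Lemma qg_inv_pi g : qg_inv (\pi_quotient_group g) = \pi_quotient_group g^-1.
Proof.
apply/eqP/quotient_piP; rewrite invgK.
have := normalV hN (normalJ hN g^-1 (repr_pi_quotient g)).
by rewrite conjgE -mulgA mulgV mulg1 !invgM !invgK.
Qed.

Lemma qg_mulA : associative qg_mul.
Proof.
elim/quotW=> g; elim/quotW=> h; elim/quotW=> k.
by rewrite (qg_mul_pi h k) (qg_mul_pi g h) !qg_mul_pi mulgA.
Qed.

Lemma qg_mul1 : left_id qg_one qg_mul.
Proof. by elim/quotW=> g; rewrite qg_mul_pi mul1g. Qed.

Lemma qg_mulr1 : right_id qg_one qg_mul.
Proof. by elim/quotW=> g; rewrite qg_mul_pi mulg1. Qed.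

Lemma qg_mulV : left_inverse qg_one qg_inv qg_mul.
Proof. by elim/quotW=> g; rewrite qg_inv_pi qg_mul_pi mulVg. Qed.

Lemma qg_mulrV : right_inverse qg_one qg_inv qg_mul.
Proof. by elim/quotW=> g; rewrite qg_inv_pi qg_mul_pi mulgV. Qed.

HB.instance Definition _ := isGroup.Build quotient_group
  qg_mulA qg_mul1 qg_mulr1 qg_mulV qg_mulrV.

End Quotient.

Definition presented_group (X : choiceType) (R : set (free_group X)) : groupType :=
  quotient_group (normal_closureP R).

Definition presented_gen (X : choiceType) (R : set (free_group X)) (x : X) :
  presented_group R := \pi_(quotient_group (normal_closureP R)) (free_gen x).

Section WordMetric.
Variable G : groupType.
Implicit Types (A : set G) (g h : G).

Definition expressible A g n := exists s : seq G,
  [/\ size s = n, forall x, x \in s -> A x \/ A x^-1 & g = \prod_(x <- s) x].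

Definition generating_set A := forall g, exists n, expressible A g n.

Definition finite_generating_set A := finite_set A /\ generating_set A.

Definition finitely_generated := exists A, finite_generating_set A.

(* The default value 0 of xget is only reached when A does not generate g. *)
Definition word_length A g : nat :=
  xget 0%N [set n | expressible A g n /\ forall m, expressible A g m -> (n <= m)%N].

Definition word_dist (R : realType) A g h : R :=
  ((word_length A (g^-1 * h))%:R)%R.

End WordMetric.

Section QuasiIsometry.
Local Open Scope ring_scope.

Definition quasi_isometry (R : realType) (Y Z : Type)
    (dY : Y -> Y -> R) (dZ : Z -> Z -> R) (f : Y -> Z) :=
  exists K C : R,
    [/\ 1 <= K, 0 <= C,
        forall x y, K^-1 * dY x y - C <= dZ (f x) (f y) <= K * dY x y + C
      & forall z, exists y, dZ z (f y) <= C].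

Definition quasi_isometric_groups (R : realType) (G H : groupType) :=
  exists (A : set G) (B : set H) (f : G -> H),
    [/\ finite_generating_set A, finite_generating_set B
      & quasi_isometry (word_dist R A) (word_dist R B) f].

End QuasiIsometry.

Lemma presented_group_fg (X : choiceType) (R : set (free_group X)) :
  finite_set [set: X] -> finitely_generated (presented_group R).
Proof.
move=> finX; exists [set presented_gen R x | x in [set: X]]; split.
  exact: finite_image.
move=> g.
pose l (p : X * bool) : presented_group R :=
  if p.2 then (presented_gen R p.1)^-1 else presented_gen R p.1.
pose q w : presented_group R :=
  \pi_(quotient_group (normal_closureP R)) (\pi_(free_group X) w).
have qcat s t : q (s ++ t) = q s * q t.
  by rewrite [RHS](qg_mul_pi (normal_closureP R)) /q; congr (\pi _); rewrite -fg_mul_pi.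
have q1 p : q [:: p] = l p.
  case: p => x [] //; rewrite /l /=.
  by rewrite [RHS](qg_inv_pi (normal_closureP R)) /q; congr (\pi _); rewrite [RHS]fg_inv_pi.
have -> : g = q (repr (repr (g : quotient_group (normal_closureP R)))).
  by rewrite /q !reprK.
move: (repr _) => w; exists (size w), (map l w); split; first by rewrite size_map.
  move=> x /mapP[[y b] _ ->]; case: b; rewrite /l /=; last by left; exists y.
  by right; rewrite invgK; exists y.
elim: w => [|p w IH] /=; first by rewrite big_nil.
by rewrite big_cons -IH -cat1s qcat q1.
Qed.

(* MathComp's [~ x, y] is x^-1 * y^-1 * x * y, a different convention. *)
Definition comm (G : groupType) (x y : G) : G := x * y * x^-1 * y^-1.

Definition F2 := free_group bool.
Definition F2a : F2 := free_gen false.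
Definition F2b : F2 := free_gen true.

Definition relator (n : nat) : F2 :=
  \prod_(1 <= i < 101) comm (F2a ^+ i) (F2b ^+ (2 ^ (2 ^ n))%N).

Definition bowditch_group (S : set nat) : groupType :=
  presented_group (relator @` S).

Lemma bowditch_group_fg S : finitely_generated (bowditch_group S).
Proof. exact/presented_group_fg/finite_finset. Qed.

(* Main.v *)
Require Import Defs.
From HB Require Import structures.
From mathcomp Require Import all_boot all_order all_algebra.
From mathcomp Require Import boolp classical_sets cardinality reals.
From mathcomp Require Import realalg ring lra zify.
Import Order.TTheory GRing.Theory Num.Theory.

(** Put N m = 2^(2^m) and write G(T) for the group with relators w_m, m in T.

Every w_m has exponent sum zero in b.  In terms of s_j = b^j a b^-j, the
relator w_m is V(s_0, s_(N m)) with V(s, t) the product of s^i t^-i for i from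
1 to 100, so G(T) is the extension by the integers of the group A(T) with
generators s_j, for j an integer, and relators V(s_j, s_(j + N m)), for m in T.
The relators of A(T) sit on the edges of a graph on the integers, and no sum
of two numbers N m is again such a number, so this graph has no triangle.

The crucial fact is [parabolic_embedding]: in a group with one relator V(s, t)
on each edge of a triangle-free graph, a set of vertices generates the group
presented by the full subgraph that it spans.  It is enough to remove one
vertex t at a time.  The neighbours of t span no edge, so by induction they
generate a free group F in the group of the remaining vertices; they also
generate a free group in the group of the star around t ([star_group]).  The
two groups therefore embed in a common group where they agree on F
([permutational_product]), and in that group all the relators hold.

This fact has two consequences for G(T).  A relation of length at most L only
involves the s_j with |j| <= L, so it follows from the w_m with N m <= 2 L
([short_relation]).  And w_n does not follow from the other relators, since
s_0 and s_(N n) are then not adjacent, hence free ([relator_independent]).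

Suppose now that G(S) and G(S') are quasi-isometric and that n is in S but not
in S'. The relator w_n is a loop of length comparable to N n in G(S). It is
mapped to a loop of comparable length in G(S'), which follows from the w_m with
m < n because N (n + 1) is the square of N n and w_n is not a relator; these
have length comparable to the square root of N n. Mapping this filling back
([coarse_filling]), w_n follows from relations of G(S) of length at most a
constant times the square root of N n, hence from the w_m with m in S and m < n,
once n is large. This contradicts the independence of w_n, so S minus S' is
finite, and likewise S' minus S. *)

Set Implicit Arguments.
Unset Strict Implicit.
Unset Printing Implicit Defensive.

Local Open Scope quotient_scope.
Local Open Scope classical_set_scope.
Local Open Scope group_scope.

(** * Words, homomorphisms and presentations *)

Section Morphisms.
Variables (P Q : groupType) (h : P -> Q).
Hypothesis hM : {morph h : x y / x * y}.

Lemma morph_one : h 1 = 1.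
Proof. by apply: (mulgI (h 1)); rewrite -hM !mulg1. Qed.

Lemma morph_inv x : h x^-1 = (h x)^-1.
Proof. by apply: (mulgI (h x)); rewrite -hM !mulgV morph_one. Qed.

Lemma morph_exp x n : h (x ^+ n) = h x ^+ n.
Proof. by elim: n => [|n IH]; rewrite ?expg0 ?morph_one // !expgS hM IH. Qed.

Lemma morph_prod I (s : seq I) (F : I -> P) :
  h (\prod_(i <- s) F i) = \prod_(i <- s) h (F i).
Proof. by elim: s => [|i s IH]; rewrite ?big_nil ?morph_one // !big_cons hM IH. Qed.

Lemma morph_inj : (forall x, h x = 1 -> x = 1) -> injective h.
Proof.
move=> h1 x y hxy; apply: (mulIg y^-1); rewrite mulgV.
by apply: h1; rewrite hM morph_inv hxy mulgV.
Qed.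

End Morphisms.

Section WordEvaluation.
Variable X : choiceType.

Definition weval (P : groupType) (phi : X -> P) (w : fword X) : P :=
  \prod_(p <- w) (if p.2 then (phi p.1)^-1 else phi p.1).

(** Words are kept apart from the elements of the free group because lengths,
letters and paths only make sense for words. *)
Definition word_elt (w : fword X) : free_group X := \pi_(free_group X) w.

Lemma word_elt_cat s t : word_elt (s ++ t) = word_elt s * word_elt t.
Proof. by rewrite /word_elt -fg_mul_pi. Qed.

Lemma word_elt_eq1 w : word_elt w = 1 <-> free_eq w [::].
Proof. by split=> [/eqP/free_piP|/free_piP/eqP]. Qed.

Lemma word_elt_winv w : word_elt (winv w) = (word_elt w)^-1.
Proof. by rewrite /word_elt -fg_inv_pi. Qed.

Variable P : groupType.
Implicit Types phi : X -> P.

Lemma weval_nil phi : weval phi [::] = 1.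
Proof. exact: big_nil. Qed.

Lemma weval_cons phi p w :
  weval phi (p :: w) = (if p.2 then (phi p.1)^-1 else phi p.1) * weval phi w.
Proof. exact: big_cons. Qed.

Lemma weval_cat phi s t : weval phi (s ++ t) = weval phi s * weval phi t.
Proof. exact: big_cat. Qed.

Lemma weval_free_eq phi s t : free_eq s t -> weval phi s = weval phi t.
Proof.
elim=> {s t} [//|s t _ -> //|s t u _ -> _ -> //|s t x b].
by rewrite !weval_cat !weval_cons /=; case: b; rewrite /= ?mulVKg ?mulKg.
Qed.

Lemma weval_winv phi w : weval phi (winv w) = (weval phi w)^-1.
Proof.
apply: (mulIg (weval phi w)); rewrite mulVg -weval_cat.
by rewrite (weval_free_eq _ (free_eq_winvl w)) weval_nil.
Qed.

Lemma eq_weval phi psi w : {in w, forall p, phi p.1 = psi p.1} ->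
  weval phi w = weval psi w.
Proof. by move=> e; apply: eq_big_seq => p /e ->. Qed.

Definition free_lift phi (g : free_group X) : P := weval phi (repr g).

Lemma free_lift_word phi w : free_lift phi (word_elt w) = weval phi w.
Proof. exact/weval_free_eq/repr_pi_free. Qed.

Lemma word_eltK (g : free_group X) : word_elt (repr g) = g.
Proof. exact: reprK. Qed.

Lemma free_liftM phi : {morph free_lift phi : x y / x * y}.
Proof.
move=> x y; rewrite -[x]word_eltK -[y]word_eltK -word_elt_cat !free_lift_word.
exact: weval_cat.
Qed.

Lemma free_lift_gen phi x : free_lift phi (free_gen x) = phi x.
Proof.
by rewrite [free_gen x]/(word_elt _) free_lift_word weval_cons weval_nil mulg1.
Qed.

End WordEvaluation.

Lemma morph_weval (X : choiceType) (P Q : groupType) (h : P -> Q) (phi : X -> P) w :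
  {morph h : x y / x * y} -> h (weval phi w) = weval (h \o phi) w.
Proof.
move=> hM; rewrite /weval morph_prod //; apply: eq_bigr => -[x b] _ /=.
by case: b; rewrite ?morph_inv.
Qed.

Lemma word_elt_weval (X : choiceType) (w : fword X) :
  word_elt w = weval (@free_gen X) w.
Proof.
elim: w => [|[x b] w IH]; first by rewrite weval_nil.
rewrite weval_cons -IH -cat1s word_elt_cat; congr (_ * _).
by case: b => //=; rewrite -[X in X^-1]/(word_elt _) -word_elt_winv.
Qed.

Section Presentations.
Variables (X : choiceType) (R : set (free_group X)).

Lemma presented_weval w : weval (presented_gen R) w =
  \pi_(quotient_group (normal_closureP R)) (word_elt w).
Proof.
rewrite word_elt_weval.
rewrite (@morph_weval X (free_group X) (presented_group R)
  (fun g => \pi_(quotient_group (normal_closureP R)) g)) //.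
by move=> x y; rewrite -[LHS](qg_mul_pi (normal_closureP R)).
Qed.

Lemma presented_eq1 w :
  weval (presented_gen R) w = 1 <-> normal_closure R (word_elt w).
Proof.
rewrite presented_weval; split=> [/esym/eqP/quotient_piP|h].
  by rewrite invg1 mul1g.
by apply/esym/eqP/quotient_piP; rewrite invg1 mul1g.
Qed.

Lemma presented_surj (g : presented_group R) :
  exists w, weval (presented_gen R) w = g.
Proof.
exists (repr (repr (g : quotient_group (normal_closureP R)))).
by rewrite presented_weval word_eltK; exact: reprK.
Qed.

Lemma sub_normal_closure (N : set (free_group X)) : normal_subgroup N ->
  R `<=` N -> normal_closure R `<=` N.
Proof. by move=> hN RN g; apply. Qed.

Lemma normal_closure_gen : R `<=` normal_closure R.
Proof. by move=> g Rg N [_]; apply. Qed.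

(** The universal property of a presentation.  It serves to keep an element out
of a normal closure and to carry relations from one group to another, by
exhibiting a group in which the relators hold. *)
Lemma normal_closure_lift (P : groupType) (phi : X -> P) g :
  (forall r, R r -> free_lift phi r = 1) -> normal_closure R g -> free_lift phi g = 1.
Proof.
move=> phiR; apply: (sub_normal_closure (N := [set g | free_lift phi g = 1])) => //.
have hM := free_liftM phi.
split=> /= [|x y hx hy|x hx|x y hx].
- exact: morph_one.
- by rewrite hM hx hy mulg1.
- by rewrite morph_inv // hx invg1.
- by rewrite conjgE !hM morph_inv // hx mul1g mulVg.
Qed.

Lemma presented_free_liftE g :
  free_lift (presented_gen R) g = 1 <-> normal_closure R g.
Proof. by rewrite -[g]word_eltK free_lift_word; exact: presented_eq1. Qed.

End Presentations.

Lemma normal_closureS (X : choiceType) (R R' : set (free_group X)) :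
  R `<=` normal_closure R' -> normal_closure R `<=` normal_closure R'.
Proof. by move=> RR'; apply: sub_normal_closure RR'; exact: normal_closureP. Qed.

(** * Permutation groups and amalgams *)

Section SymmetricGroup.
Variable T : Type.

(** The symmetric group of an arbitrary type, in which all the groups that test
presentations are built. *)
Record sym := Sym {
  sym_fun : T -> T;
  sym_finv : T -> T;
  sym_funK : cancel sym_fun sym_finv;
  sym_finvK : cancel sym_finv sym_fun }.

HB.instance Definition _ := gen_eqMixin sym.
HB.instance Definition _ := gen_choiceMixin sym.

Lemma sym_eqP (u v : sym) : sym_fun u =1 sym_fun v -> u = v.
Proof.
case: u v => [f f' fK f'K] [g g' gK g'K] /= /funext fg.
have {}fg' : f' = g'.
  by apply: funext => x; rewrite -[in LHS](g'K x) -fg fK.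
by subst g g'; congr Sym; exact: Prop_irrelevance.
Qed.

Definition sym_one := @Sym id id (fun=> erefl) (fun=> erefl).
Definition sym_mul (u v : sym) := Sym
  (can_comp (sym_funK u) (sym_funK v)) (can_comp (sym_finvK v) (sym_finvK u)).
Definition sym_inv (u : sym) := Sym (sym_finvK u) (sym_funK u).

Lemma sym_mulA : associative sym_mul.
Proof. by move=> u v w; exact: sym_eqP. Qed.
Lemma sym_mul1 : left_id sym_one sym_mul.
Proof. by move=> u; exact: sym_eqP. Qed.
Lemma sym_mulr1 : right_id sym_one sym_mul.
Proof. by move=> u; exact: sym_eqP. Qed.
Lemma sym_mulV : left_inverse sym_one sym_inv sym_mul.
Proof. by move=> u; apply: sym_eqP => x; exact: sym_funK. Qed.
Lemma sym_mulrV : right_inverse sym_one sym_inv sym_mul.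
Proof. by move=> u; apply: sym_eqP => x; exact: sym_finvK. Qed.

HB.instance Definition _ := isGroup.Build sym
  sym_mulA sym_mul1 sym_mulr1 sym_mulV sym_mulrV.

Lemma sym_mulE (u v : sym) x : sym_fun (u * v) x = sym_fun u (sym_fun v x).
Proof. by []. Qed.

Lemma sym_invE (u : sym) x : sym_fun u^-1 x = sym_finv u x.
Proof. by []. Qed.

Lemma sym_oneE x : sym_fun (1 : sym) x = x.
Proof. by []. Qed.

End SymmetricGroup.

Section CosetSplitting.
Variables (F G : groupType) (i : F -> G).
Hypotheses (iM : {morph i : x y / x * y}) (i_inj : injective i).

(** A representative of the right coset of g which depends only on that coset,
because [xget] chooses from a set and not from a description of it. *)
Definition coset_repr (g : G) : G := xget g [set h | exists f, h = i f * g].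

Lemma coset_reprP g : exists f, g = i f * coset_repr g.
Proof.
have [f hf] : [set h | exists f, h = i f * g] (coset_repr g).
  by apply: xgetPex; exists g, 1; rewrite morph_one ?mul1g.
by exists f^-1; rewrite hf morph_inv // mulKg.
Qed.

Definition coset_coord (g : G) : F := projT1 (cid (coset_reprP g)).

Lemma coset_split g : g = i (coset_coord g) * coset_repr g.
Proof. exact: projT2 (cid (coset_reprP g)). Qed.

Lemma coset_reprM f g : coset_repr (i f * g) = coset_repr g.
Proof.
have E : [set h | exists f', h = i f' * (i f * g)] =
         [set h | exists f', h = i f' * g].
  apply/seteqP; split=> h /= [f' ->].
    by exists (f' * f); rewrite iM mulgA.
  by exists (f' * f^-1); rewrite iM morph_inv // -mulgA mulKg.
rewrite /coset_repr E /xget; case: pselect => // h; case: h.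
by exists g; apply/asboolP; exists 1; rewrite morph_one ?mul1g.
Qed.

Lemma coset_coordM f g : coset_coord (i f * g) = f * coset_coord g.
Proof.
apply: i_inj; apply: (mulIg (coset_repr g)).
by rewrite iM -[in LHS](coset_reprM f) -coset_split -mulgA -coset_split.
Qed.

Lemma coset_coord_repr g : coset_coord (coset_repr g) = 1.
Proof.
have : coset_coord g = coset_coord g * coset_coord (coset_repr g).
  by rewrite -coset_coordM -coset_split.
by rewrite -[in LHS](mulg1 (coset_coord g)) => /mulgI.
Qed.

Lemma coset_repr_repr g : coset_repr (coset_repr g) = coset_repr g.
Proof. by rewrite -(coset_reprM (coset_coord g) (coset_repr g)) -coset_split. Qed.

End CosetSplitting.

(** Any two groups with a common subgroup F embed in a common group that
identifies the two copies of F (B. H. Neumann's permutational product).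
Choosing coset representatives identifies each G_k with a product of F and the
set of its cosets.  The set G1 * G2 then has two coordinates in F, and
[coord_swap] exchanges them.  Let G1 act by left multiplication on the first
factor, and G2 by left multiplication on the second factor conjugated by the
swap: both actions of F become left multiplication of the same F-coordinate. *)
Section PermutationalProduct.
Variables (F G1 G2 : groupType) (i : F -> G1) (j : F -> G2).
Hypotheses (iM : {morph i : x y / x * y}) (jM : {morph j : x y / x * y}).
Hypotheses (i_inj : injective i) (j_inj : injective j).

Definition left_fst (g : G1) : sym (G1 * G2).
Proof.
exists (fun x => (g * x.1, x.2)) (fun x => (g^-1 * x.1, x.2)).
- by case=> x y; rewrite /= mulKg.
- by case=> x y; rewrite /= mulVKg.
Defined.

Definition left_snd (g : G2) : sym (G1 * G2).
Proof.
exists (fun x => (x.1, g * x.2)) (fun x => (x.1, g^-1 * x.2)).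
- by case=> x y; rewrite /= mulKg.
- by case=> x y; rewrite /= mulVKg.
Defined.

Let swap (x : G1 * G2) : G1 * G2 :=
  (i (coset_coord jM x.2) * coset_repr i x.1,
   j (coset_coord iM x.1) * coset_repr j x.2).

Let swapK : involutive swap.
Proof.
case=> x y; rewrite /swap /= !coset_coordM // !coset_coord_repr // !mulg1.
by rewrite !coset_reprM // !coset_repr_repr // -!coset_split.
Qed.

Definition coord_swap : sym (G1 * G2) := Sym swapK swapK.

Lemma permutational_product : exists (P : groupType) (h1 : G1 -> P) (h2 : G2 -> P),
  [/\ {morph h1 : x y / x * y}, {morph h2 : x y / x * y},
      injective h1 & forall f, h1 (i f) = h2 (j f)].
Proof.
exists (sym (G1 * G2)), left_fst, (fun g => left_snd g ^ coord_swap); split.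
- by move=> g h; apply: sym_eqP => x; rewrite sym_mulE /= mulgA.
- move=> g h; rewrite -conjMg; congr (_ ^ _).
  by apply: sym_eqP => x; rewrite sym_mulE /= mulgA.
- by move=> g h /(congr1 (fun u : sym _ => (sym_fun u (1, 1)).1)); rewrite /= !mulg1.
move=> f; apply: (mulgI coord_swap); rewrite -conjgC; apply: sym_eqP => -[x y].
rewrite !sym_mulE /= /swap /=.
by rewrite coset_reprM // coset_coordM // jM mulgA.
Qed.

End PermutationalProduct.

(** * Groups of stars *)

(** With s = a and t = b^N a b^-N this is the word w of the presentation. It
vanishes for s = t, and in abelian groups it is a power of s t^-1. *)
Definition edge_relator (P : groupType) (s t : P) : P :=
  \prod_(1 <= i < 101) (s ^+ i * t ^- i).

Lemma morph_edge_relator (P Q : groupType) (h : P -> Q) s t :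
  {morph h : x y / x * y} -> h (edge_relator s t) = edge_relator (h s) (h t).
Proof.
move=> hM; rewrite /edge_relator morph_prod //; apply: eq_bigr => i _.
by rewrite hM (morph_inv hM) !(morph_exp hM).
Qed.

(** The relator V holds between the two affine maps z |-> alpha z + 1 and
z |-> alpha z: for each i the quotient of their i-th powers is the translation by
1 + alpha + ... + alpha^(i-1), and alpha is chosen so that these translations
sum to zero.  This is stated for translations y and a dilation t in any group. *)
Section AffineRelation.
Variables (R : comRingType) (alpha : R) (P : groupType) (y : R -> P) (t : P).
Hypothesis yD : forall u v, y (u + v)%R = y u * y v.
Hypothesis ty : forall z, t * y z = y (alpha * z)%R * t.
Hypothesis alpha0 : (\sum_(1 <= i < 101) \sum_(j < i) alpha ^+ j = 0)%R.

Lemma translation0 : y 0%R = 1.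
Proof. by apply: (mulgI (y 0%R)); rewrite -yD addr0 mulg1. Qed.

Lemma translationN z : y (- z)%R = (y z)^-1.
Proof. by apply: (mulgI (y z)); rewrite -yD subrr mulgV translation0. Qed.

Lemma translation_sum I (r : seq I) (F : I -> R) :
  y (\sum_(i <- r) F i)%R = \prod_(i <- r) y (F i).
Proof.
by elim: r => [|i r IH]; rewrite ?big_nil ?translation0 // !big_cons yD IH.
Qed.

Lemma affine_exp i :
  (y 1%R * t) ^+ i * t ^- i = y (\sum_(j < i) alpha ^+ j)%R.
Proof.
elim: i => [|i IH]; first by rewrite !expg0 mulgV big_ord0 translation0.
rewrite big_ord_recl /= expr0 yD.
under eq_bigr do rewrite exprS.
rewrite -mulr_sumr !expgS invgM -!mulgA; congr (_ * _).
by rewrite (mulgA _ (t ^- i)) IH mulgA ty mulgK.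
Qed.

Lemma edge_relator_affine : edge_relator (y 1%R * t) t = 1.
Proof.
rewrite /edge_relator; under eq_bigr do rewrite affine_exp.
by rewrite -translation_sum alpha0 translation0.
Qed.

Lemma edge_relator_affineC : edge_relator t (y 1%R * t) = 1.
Proof.
rewrite /edge_relator.
transitivity (\prod_(1 <= i < 101) y (- \sum_(j < i) alpha ^+ j)%R).
  by apply: eq_bigr => i _; rewrite translationN -affine_exp invgM invgK.
by rewrite -translation_sum sumrN alpha0 oppr0 translation0.
Qed.

End AffineRelation.

(** An admissible ratio which is not a root of unity.  Up to the factor alpha - 1,
the condition is that the powers alpha^i sum to 100.  At -2 the sum is at least
100 because the terms of index 2k - 1 and 2k add up to 2^(2k-1); at -1 it is 0. *)
Lemma edge_relator_root (R : rcfType) : exists2 alpha : R, (alpha < -1)%R &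
  (\sum_(1 <= i < 101) \sum_(j < i) alpha ^+ j = 0)%R.
Proof.
pose g : {poly R} := (\sum_(1 <= i < 101) ('X^i - 1))%R.
have gE x : g.[x]%R = (\sum_(1 <= i < 101) (x ^+ i - 1))%R.
  by rewrite horner_sum; apply: eq_bigr => i _; rewrite !hornerE.
have g2 : (0 <= g.[- (2%:R)])%R.
  rewrite gE -[101%N]/(2 * 50).+1; elim: 50 => [|k IH]; first by rewrite big_nil.
  rewrite mulnS addnC !addnS addn0 big_nat_recr //= big_nat_recr //= -addrA.
  apply: addr_ge0 => //.
  rewrite !exprS exprM sqrrN -[(2 ^+ 2)%R]natrX.
  have : (1 <= (2 ^ 2)%:R ^+ k :> R)%R by apply: exprn_ege1; rewrite ler1n.
  lra.
have g1 : (g.[-1] = - (100%:R))%R.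
  rewrite gE -[101%N]/(2 * 50).+1 -[100%N]/(2 * 50)%N.
  elim: 50 => [|k IH]; first by rewrite big_nil oppr0.
  rewrite mulnS addnC !addnS addn0 big_nat_recr //= big_nat_recr //= IH.
  by rewrite !exprS exprM sqrrN expr1n expr1n -(addn2 (2 * k)) natrD; ring.
have [||x /andP[x2 x1] gx] := @poly_ivt R (- g)%R (- (2%:R))%R (-1)%R.
- lra.
- by rewrite !hornerN g1 opprK ler0n oppr_le0 g2.
have {}gx : g.[x]%R = 0%R.
  by move/rootP: gx; rewrite hornerN => /eqP; rewrite oppr_eq0 => /eqP.
exists x.
  rewrite lt_neqAle x1 andbT; apply/eqP => x1E.
  by move: gx; rewrite x1E g1 => /eqP; rewrite oppr_eq0 pnatr_eq0.
apply: (@mulfI _ (x - 1)%R); first by rewrite lt_eqF //; lra.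
rewrite mulr0 -[RHS]gx gE mulr_sumr; apply: eq_bigr => i _.
by rewrite subrX1.
Qed.

(** A free product of copies of the additive group R, one for each k in K,
represented by permutations of its normal forms.  A normal form is a sequence
of syllables (k, x) with x nonzero and no two consecutive equal k.  Every k
splits a normal form into its k-coefficient at the head (zero if the
head is not a k-syllable) and the rest, and the k-th copy of R translates the
coefficient.  Scaling all syllables by alpha is an automorphism which normalizes
every copy of R, so each copy, together with the scaling, generates an affine
group.  The translations fix the sequences that are not normal forms, which
avoids a subtype. *)
Section FreeProduct.
Variables (R : realFieldType) (K : eqType) (alpha : R).
Hypothesis alpha_lt : (alpha < -1)%R.
Implicit Types (s r : seq (K * R)) (k : K) (x z : R).

Let alpha_neq0 : alpha != 0%R.
Proof. by rewrite lt_eqF //; move: alpha_lt; lra. Qed.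

Definition coef k s : R :=
  if s is p :: _ then (if p.1 == k then p.2 else 0%R) else 0%R.
Definition rest k s :=
  if s is p :: s' then (if p.1 == k then s' else s) else s.
Definition push k x s := if x == 0%R then s else (k, x) :: s.
Definition off_head k s := if s is p :: _ then p.1 != k else true.

Definition alternating s :=
  sorted (fun p q => q.1 != p.1) s && all (fun p : K * R => p.2 != 0%R) s.

Lemma coef_push k x s : off_head k s -> coef k (push k x s) = x.
Proof.
rewrite /push; case: eqP => [->|_] /=; last by rewrite eqxx.
by case: s => //= p s /negPf ->.
Qed.

Lemma rest_push k x s : off_head k s -> rest k (push k x s) = s.
Proof.
rewrite /push; case: eqP => [_|_] /=; last by rewrite eqxx.
by case: s => //= p s /negPf ->.
Qed.

Lemma alternating_push k x s :
  off_head k s -> alternating s -> alternating (push k x s).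
Proof.
rewrite /push /alternating; case: eqP => //= /eqP x0.
by case: s => [_ _|p s] /=; rewrite x0 // => -> /and3P[-> -> ->].
Qed.

Lemma alternating_rest k s :
  alternating s -> off_head k (rest k s) /\ alternating (rest k s).
Proof.
rewrite /alternating; case: s => [|p s] //=; case: (p.1 =P k) => /= [<-|/eqP //].
by case: s => [|q s] //= /andP[/andP[-> ->]] /and3P[_ -> ->].
Qed.

Lemma push_rest k s : alternating s -> push k (coef k s) (rest k s) = s.
Proof.
rewrite /push /alternating; case: s => [|[k' x] s] /=; first by rewrite eqxx.
by case: (k' =P k) => [-> /and3P[_ /negPf ->]|]; rewrite ?eqxx.
Qed.

Lemma coef_neq k k' s : coef k s != 0%R -> k' != k -> coef k' s = 0%R.
Proof.
case: s => [|p s] //=; case: (p.1 =P k) => [->|]; last by rewrite eqxx.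
by move=> _ kk; rewrite eq_sym (negPf kk).
Qed.

Definition translate k z s :=
  if alternating s then push k (coef k s + z)%R (rest k s) else s.

Lemma alternating_translate k z s :
  alternating (translate k z s) = alternating s.
Proof.
rewrite /translate; case: (boolP (alternating s)) => [s_alt|/negPf //].
by have [? ?] := alternating_rest k s_alt; rewrite alternating_push.
Qed.

Lemma coef_translate k z s : alternating s ->
  coef k (translate k z s) = (coef k s + z)%R.
Proof.
move=> s_alt; rewrite /translate s_alt coef_push //.
by have [] := alternating_rest k s_alt.
Qed.

Lemma translateD k z z' s :
  translate k z (translate k z' s) = translate k (z + z')%R s.
Proof.
rewrite [LHS]/translate alternating_translate.
case: ifP => [s_alt|nalt]; last by rewrite /translate nalt.
rewrite coef_translate //.
have [? ?] := alternating_rest k s_alt.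
by rewrite /translate s_alt rest_push // -addrA (addrC z').
Qed.

Lemma translate0 k s : translate k 0%R s = s.
Proof. by rewrite /translate; case: ifP => // ?; rewrite addr0 push_rest. Qed.

Lemma translateK k z : cancel (translate k z) (translate k (- z)%R).
Proof. by move=> s; rewrite translateD addNr translate0. Qed.

Lemma translateNK k z : cancel (translate k (- z)%R) (translate k z).
Proof. by move=> s; rewrite translateD subrr translate0. Qed.

Definition translation k z := Sym (translateK k z) (translateNK k z).

Definition scale (a : R) s := [seq (p.1, (a * p.2)%R) | p <- s].

Lemma scaleK (a : R) : a != 0%R -> cancel (scale a) (scale a^-1%R).
Proof.
move=> a0 s; rewrite /scale -map_comp map_id_in // => -[k x] _ /=.
by rewrite mulKf.
Qed.

Lemma scaleVK (a : R) : a != 0%R -> cancel (scale a^-1%R) (scale a).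
Proof.
move=> a0 s; rewrite /scale -map_comp map_id_in // => -[k x] _ /=.
by rewrite mulVKf.
Qed.

Definition scaling := Sym (scaleK alpha_neq0) (scaleVK alpha_neq0).

Lemma alternating_scale (a : R) s : a != 0%R -> alternating (scale a s) = alternating s.
Proof.
move=> a0; rewrite /alternating sorted_map all_map; congr (_ && _).
by apply: eq_all => p /=; rewrite mulf_eq0 (negPf a0).
Qed.

Lemma coef_scale (a : R) k s : coef k (scale a s) = (a * coef k s)%R.
Proof. by case: s => [|p s] /=; rewrite ?mulr0 //; case: ifP; rewrite ?mulr0. Qed.

Lemma rest_scale (a : R) k s : rest k (scale a s) = scale a (rest k s).
Proof. by case: s => [|p s] //=; case: ifP. Qed.

Lemma scaling_translation k z :
  scaling * translation k z = translation k (alpha * z)%R * scaling.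
Proof.
apply: sym_eqP => s; rewrite !sym_mulE /= /translate alternating_scale //.
case: ifP => // s_alt; rewrite coef_scale rest_scale -mulrDr.
by rewrite /push mulf_eq0 (negPf alpha_neq0) /=; case: ifP.
Qed.

Lemma translation_add k z z' :
  translation k (z + z')%R = translation k z * translation k z'.
Proof. by apply: sym_eqP => s; rewrite sym_mulE /= translateD. Qed.

Definition star_gen k := translation k 1%R * scaling.

End FreeProduct.

Section FreeReduction.
Variable X : choiceType.

Definition freely_reduced (w : fword X) :=
  sorted (fun p q => q != (p.1, ~~ p.2)) w.

Lemma freely_reduced_ex w : exists2 v, freely_reduced v & free_eq w v.
Proof.
elim: w => [|[x b] w [v vred wv]]; first by exists [::] => //; exact: free_eq_refl.
have step : free_eq ((x, b) :: w) ((x, b) :: v).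
  by have := free_eq_cat (free_eq_refl [:: (x, b)]) wv.
case: v vred wv step => [|q v] vred wv step; first by exists [:: (x, b)].
have [qE|qN] := eqVneq q (x, ~~ b); last first.
  by exists ((x, b) :: q :: v) => //=; rewrite qN.
exists v; first by move: vred => /path_sorted.
by apply: free_eq_trans step _; rewrite qE; exact: (@free_eq_cancel X [::]).
Qed.

End FreeReduction.

(** The affine map z |-> alpha z + 1 has its fixed point where
(alpha - 1) z + 1 vanishes, and it multiplies that quantity by alpha.  Since
|alpha| > 1, the positive powers send 0 to a point where the quantity is
larger than 1 in absolute value, and the negative powers to a point where it is
smaller.  In both cases the point is nonzero, so the syllable created by a power
of a generator is never erased by a power of another generator. *)
Section PingPong.
Variables (R : realFieldType) (X : choiceType) (alpha : R).
Hypothesis alpha_lt : (alpha < -1)%R.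

Let side (b : bool) (x : R) :=
  if b then (`|(alpha - 1) * x + 1| < 1)%R else (1 < `|(alpha - 1) * x + 1|)%R.

Let side_neq0 b x : side b x -> x != 0%R.
Proof.
by apply: contraTneq => ->; rewrite /side mulr0 add0r normr1 ltxx; case: b.
Qed.

Let norm_alpha : (1 < `|alpha|)%R.
Proof. by rewrite ltr0_norm; move: alpha_lt; lra. Qed.

Let side_pos x : x = 0%R \/ side false x -> side false (alpha * x + 1)%R.
Proof.
rewrite /side => h.
have -> : ((alpha - 1) * (alpha * x + 1) + 1 = alpha * ((alpha - 1) * x + 1))%R by ring.
rewrite normrM; have : (1 <= `|(alpha - 1) * x + 1|)%R.
  by case: h => [->|/ltW //]; rewrite mulr0 add0r normr1.
move=> h1; apply: lt_le_trans norm_alpha _.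
by rewrite ler_peMr // (le_trans _ (ltW norm_alpha)).
Qed.

Let side_neg x : x = 0%R \/ side true x -> side true (alpha^-1 * (x - 1))%R.
Proof.
rewrite /side => h; have a0 : alpha != 0%R by rewrite lt_eqF //; move: alpha_lt; lra.
have -> : ((alpha - 1) * (alpha^-1 * (x - 1)) + 1 =
  alpha^-1 * ((alpha - 1) * x + 1))%R by field.
rewrite normrM; have h1 : (`|(alpha - 1) * x + 1| <= 1)%R.
  by case: h => [->|/ltW //]; rewrite mulr0 add0r normr1.
rewrite normfV; apply: le_lt_trans (_ : (`|alpha|^-1 < 1)%R).
  by rewrite ler_piMr // invr_ge0.
by rewrite invf_lt1 // (lt_trans ltr01).
Qed.

Let act (w : fword X) := sym_fun (weval (star_gen (K := X) alpha_lt) w) [::].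

Lemma ping_pong w : freely_reduced w ->
  alternating (act w) /\
  (if w is (x, b) :: _ then side b (coef x (act w)) else act w = [::]).
Proof.
rewrite /act; elim: w => [|[x b] w IH]; first by rewrite weval_nil.
move=> red; have {}IH := IH (path_sorted red).
rewrite weval_cons sym_mulE; move: IH; move: (sym_fun (weval _ w) [::]) => s [s_alt IH].
have a0 : alpha != 0%R by rewrite lt_eqF //; move: alpha_lt; lra.
have hx : coef x s = 0%R \/ side b (coef x s).
  case: w red IH => [|[x' b'] w] red IH; first by rewrite IH; left.
  have [xx'|xx'] := eqVneq x x'.
    right; rewrite xx'; move: red IH => /= /andP[]; rewrite xx' xpair_eqE eqxx /=.
    by case: b b' => -[].
  by left; apply: coef_neq xx'; exact: side_neq0 IH.
case: b {red} hx => /= hx; rewrite ?sym_invE ?sym_mulE /=.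
  rewrite alternating_scale ?invr_eq0 // alternating_translate; split=> //.
  by rewrite coef_scale coef_translate //; exact: side_neg.
rewrite alternating_translate alternating_scale //; split=> //.
by rewrite coef_translate ?alternating_scale // coef_scale; exact: side_pos.
Qed.

Lemma star_gen_free w : weval (star_gen (K := X) alpha_lt) w = 1 -> free_eq w [::].
Proof.
have [v vred wv] := freely_reduced_ex w.
rewrite (weval_free_eq _ wv) => v1.
have := ping_pong vred; rewrite /act v1 sym_oneE => -[_].
by case: v vred wv v1 => [|[x b] v] //= _ _ _ /side_neq0; rewrite eqxx.
Qed.

End PingPong.

(** The group of the star with centre t and leaves X: the leaves generate a free
group although each of them is tied to t by a relator V, oriented either way. *)
Lemma star_group (X : choiceType) (R : rcfType) :
  exists (P : groupType) (s : X -> P) (t : P),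
  [/\ forall x, edge_relator (s x) t = 1, forall x, edge_relator t (s x) = 1 &
      forall w, weval s w = 1 -> free_eq w [::]].
Proof.
have [alpha alpha_lt alpha0] := edge_relator_root R.
exists (sym (seq (X * R))), (star_gen alpha_lt), (scaling X alpha_lt).
split=> [x|x|w]; last exact: star_gen_free.
  by apply: edge_relator_affine alpha0;
    [exact: translation_add|exact: scaling_translation].
by apply: edge_relator_affineC alpha0;
    [exact: translation_add|exact: scaling_translation].
Qed.

(** * Groups presented by graphs *)

Section GraphGroups.
Variables (X : choiceType) (E : X -> X -> Prop).
Implicit Types (D K : set X) (w : fword X).

(** The relators of the full subgraph on D.  The alphabet stays X, so that the
vertices outside D remain as free generators; this makes the groups of all
subgraphs comparable without changing the words. *)
Definition graph_relators D : set (free_group X) :=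
  [set edge_relator (free_gen p.1) (free_gen p.2) |
    p in [set p : X * X | [/\ D p.1, D p.2 & E p.1 p.2]]].

Definition adjacent x y := E x y \/ E y x.

Definition triangle_free := forall x y z,
  adjacent x y -> adjacent y z -> adjacent x z -> False.

Definition word_over D w := forall p, p \in w -> D p.1.

Lemma graph_relatorsS D D' : D `<=` D' -> graph_relators D `<=` graph_relators D'.
Proof.
by move=> DD' _ [p [/DD' Dx /DD' Dy Exy] <-]; exists p.
Qed.

Lemma lift_graph_relators (P : groupType) (phi : X -> P) D :
  (forall x y, D x -> D y -> E x y -> edge_relator (phi x) (phi y) = 1) ->
  forall g, normal_closure (graph_relators D) g -> free_lift phi g = 1.
Proof.
move=> phiE g; apply: normal_closure_lift => _ [[x y] [Dx Dy Exy] <-].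
by rewrite morph_edge_relator ?free_lift_gen //= ?phiE //; exact: free_liftM.
Qed.

Lemma graph_gen_rel D x y : D x -> D y -> E x y ->
  edge_relator (presented_gen (graph_relators D) x)
    (presented_gen (graph_relators D) y) = 1.
Proof.
move=> Dx Dy Exy; rewrite -!(free_lift_gen (presented_gen (graph_relators D))).
rewrite -morph_edge_relator; last exact: free_liftM.
apply/presented_free_liftE; apply: normal_closure_gen.
by exists (x, y).
Qed.

(** As for Coxeter groups: the vertices of K generate, in the group of D, the
group of K. *)
Definition parabolic K D := forall w, word_over K w ->
  normal_closure (graph_relators D) (word_elt w) ->
  normal_closure (graph_relators K) (word_elt w).

Hypothesis Etf : triangle_free.
Hypothesis Eirr : forall x, ~ E x x.

(** Adding a vertex t to D creates no relation between the vertices of D.  The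
neighbours of t in D span no edge since the graph has no triangle, so the
hypothesis on subsets of D makes them free in the group of D; they are free in
the star of t as well, and the two groups embed in a common one. *)
Lemma parabolic_vertex D t : ~ D t -> (forall K, K `<=` D -> parabolic K D) ->
  parabolic D (D `|` [set t]).
Proof.
move=> nDt IH w wD hw.
pose K : set X := [set x | D x /\ adjacent x t].
have [P2 [s [t2 [st ts s_free]]]] := star_group {x : X | x \in K} {realclosure rat}.
pose gen := presented_gen (graph_relators D).
pose i := free_lift (fun k : {x : X | x \in K} => gen (val k)).
have iM : {morph i : x y / x * y} := free_liftM _.
have jM : {morph free_lift s : x y / x * y} := free_liftM _.
have j_inj : injective (free_lift s).
  apply: morph_inj => // g; rewrite -[g]word_eltK free_lift_word => /s_free.
  by move/word_elt_eq1.
have i_inj : injective i.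
  apply: morph_inj => // g; rewrite -[g]word_eltK /i free_lift_word.
  move: (repr g) => v v1.
  pose v' : fword X := [seq (val p.1, p.2) | p <- v].
  have v'E (Q : groupType) (phi : X -> Q) : weval phi v' = weval (phi \o val) v.
    by rewrite /weval big_map.
  have : normal_closure (graph_relators K) (word_elt v').
    apply: (IH K) => [x []//|p /mapP[q _ ->]|]; first by have := valP q.1; rewrite inE.
    by apply/presented_eq1; rewrite v'E.
  (* K spans no edge, so any values of the vertices satisfy its relators. *)
  pose phi x := if insub x is Some k then free_gen (k : {x : X | x \in K}) else 1.
  move=> /(@lift_graph_relators _ phi); rewrite free_lift_word v'E word_elt_weval => <-.
    by apply: eq_weval => p _; rewrite /phi /= valK.
  by move=> x y [_ xt] [_ yt] Exy; case: (Etf (or_introl Exy) yt xt).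
have [P [h1 [h2 [h1M h2M h1_inj h12]]]] := permutational_product iM jM i_inj j_inj.
(* D keeps its values in its group, and t is the centre of the star. *)
pose psi x := if x == t then h2 t2 else h1 (gen x).
have psiD x : D x -> psi x = h1 (gen x).
  by rewrite /psi; case: eqP => [->|].
have psit : psi t = h2 t2 by rewrite /psi eqxx.
have psiK x : D x -> adjacent x t ->
    exists k, psi x = h2 (s k).
  move=> Dx xt; have xK : x \in K by rewrite inE.
  exists (exist _ x xK).
  by rewrite psiD // -(free_lift_gen s) -h12 /i free_lift_gen.
have psi_rel x y : (D `|` [set t]) x -> (D `|` [set t]) y -> E x y ->
    edge_relator (psi x) (psi y) = 1.
  case=> [Dx|->] [Dy|->] Exy; last by case: (Eirr Exy).
  - by rewrite !psiD // -morph_edge_relator // graph_gen_rel // morph_one.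
  - have [|k ->] := psiK x Dx; first by left.
    by rewrite psit -morph_edge_relator // st morph_one.
  - have [|k ->] := psiK y Dy; first by right.
    by rewrite psit -morph_edge_relator // ts morph_one.
have := lift_graph_relators psi_rel hw; rewrite free_lift_word.
rewrite (@eq_weval _ _ _ (h1 \o gen)); last by move=> p /wD /psiD.
rewrite -morph_weval // -(morph_one h1M) => /h1_inj.
exact: (presented_eq1 (graph_relators D) w).1.
Qed.

Lemma parabolic_trans K D D' : K `<=` D ->
  parabolic K D -> parabolic D D' -> parabolic K D'.
Proof. by move=> KD hK hD w wK hw; apply: hK => //; apply: hD => // p /wK /KD. Qed.

(** By induction on the size of the graph, removing any vertex outside K. *)
Lemma parabolic_finite (r : seq X) K : K `<=` [set` r] -> parabolic K [set` r].
Proof.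
elim/ltn_ind: {r}(size r) {-2}r (erefl (size r)) K => n IH r rn K Kr.
have [rK|/existsNP[t /not_implyP[/= rt nKt]]] := pselect ([set` r] `<=` K).
  by have -> : K = [set` r]; [exact/seteqP|move=> w].
pose D : set X := [set` [seq x <- r | x != t]].
have sD : (size [seq x <- r | x != t] < n)%N.
  rewrite -rn size_filter -(count_predC (pred1 t) r) -[X in (X < _)%N]add0n ltn_add2r.
  by rewrite -has_count has_pred1.
have -> : [set` r] = D `|` [set t].
  apply/seteqP; split=> x; rewrite /D /setU /= mem_filter.
    by have [->|] := eqVneq x t; [right|left].
  by case=> [/andP[]|->].
have hD := IH _ sD _ erefl.
have KD : K `<=` D.
  move=> x Kx; rewrite /D /= mem_filter; have /= -> := Kr _ Kx; rewrite andbT.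
  by apply: contra_notN nKt => /eqP <-.
apply: (parabolic_trans KD); first exact: hD.
by apply: parabolic_vertex => //; rewrite /D /= mem_filter eqxx.
Qed.

(** A consequence of the relators uses only finitely many of them. *)
Lemma graph_relators_compact D g : normal_closure (graph_relators D) g ->
  exists2 r : seq X, [set` r] `<=` D & normal_closure (graph_relators [set` r]) g.
Proof.
pose fin (g : free_group X) := exists2 r : seq X,
  [set` r] `<=` D & normal_closure (graph_relators [set` r]) g.
have wide (r r' : seq X) g' : {subset r <= r'} ->
    normal_closure (graph_relators [set` r]) g' ->
    normal_closure (graph_relators [set` r']) g'.
  move=> rr'; apply: normal_closureS => h hh; apply: normal_closure_gen.
  by apply: graph_relatorsS hh => x; exact: rr'.
apply: (sub_normal_closure (N := fin)); last first.
  move=> _ [[x y] [/= Dx Dy Exy] <-]; exists [:: x; y].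
    by move=> z; rewrite /= !inE => /orP[] /eqP ->.
  by apply: normal_closure_gen; exists (x, y) => //=; rewrite !inE !eqxx orbT.
have hN r := normal_closureP (graph_relators [set` (r : seq X)]).
split=> [|x y [r rD hx] [r' r'D hy]|x [r rD hx]|x y [r rD hx]].
- by exists [::] => //; exact: (normal1 (hN _)).
- exists (r ++ r') => [z|]; first by rewrite /= mem_cat => /orP[/rD|/r'D].
  by apply: (normalM (hN _)); [apply: wide hx|apply: wide hy];
    move=> z zr; rewrite mem_cat zr ?orbT.
- by exists r => //; exact: (normalV (hN r)).
- by exists r => //; exact: (normalJ (hN r)).
Qed.

Theorem parabolic_embedding K D : K `<=` D -> parabolic K D.
Proof.
move=> KD w wK /graph_relators_compact[r rD hw].
pose r' := [seq p.1 | p <- w] ++ r.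
pose K' := K `&` [set` r'].
have wK' : word_over K' w.
  move=> p pw; split; first exact: wK.
  by rewrite /= mem_cat; apply/orP; left; apply: map_f.
have hw' : normal_closure (graph_relators [set` r']) (word_elt w).
  apply: normal_closureS hw => h hh; apply: normal_closure_gen.
  by apply: graph_relatorsS hh => x; rewrite /= mem_cat => ->; rewrite orbT.
have hK' : normal_closure (graph_relators K') (word_elt w).
  by apply: (@parabolic_finite r') hw' => // x [].
apply: normal_closureS hK' => h hh; apply: normal_closure_gen.
by apply: graph_relatorsS hh => x [].
Qed.

End GraphGroups.

(** * Relations in Bowditch's groups *)

Definition tower (n : nat) : nat := (2 ^ (2 ^ n))%N.

Lemma towerS n : tower n.+1 = (tower n * tower n)%N.
Proof. by rewrite /tower expnS mul2n -addnn expnD. Qed.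

Lemma leq_tower m n : (m <= n)%N -> (tower m <= tower n)%N.
Proof. by move=> mn; rewrite /tower !leq_exp2l. Qed.

Lemma tower_inj : injective tower.
Proof. by move=> m n /expnI -/(_ isT) /expnI; exact. Qed.

Lemma tower_gt n : (n < tower n)%N.
Proof. by apply: (@leq_trans (2 ^ n)); [|apply: ltnW]; exact: ltn_expl. Qed.

(** If i <= j then the sum lies strictly between tower j and its square, which is
the next value of the tower. *)
Lemma tower_sum i j k : (0 < i)%N -> (0 < j)%N -> (tower i + tower j)%N <> tower k.
Proof.
wlog ij : i j / (i <= j)%N.
  move=> h i0 j0; case: (leqP i j) => [|/ltnW] ij; first exact: h.
  by rewrite addnC; exact: h.
move=> i0 j0 E.
have tj : (2 < tower j)%N.
  by apply: (@leq_trans (tower 1)); [|exact: leq_tower].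
have jk : (j < k)%N.
  rewrite ltnNge; apply/negP => /leq_tower; rewrite -E.
  by have := tower_gt i; lia.
have := leq_tower jk; rewrite towerS -E; have := leq_tower ij; nia.
Qed.

Definition tower_edge (T : set nat) (x y : int) : Prop :=
  exists2 m, T m & y = (x + (tower m)%:Z)%R.

Lemma tower_edge_irr T x : ~ tower_edge T x x.
Proof. by move=> [m _]; have := tower_gt m; lia. Qed.

Lemma tower_edge_triangle_free (T : set nat) :
  T `<=` [set n | (100 < n)%N] -> triangle_free (tower_edge T).
Proof.
move=> T100 x y z.
have T0 m : T m -> (0 < m)%N by move=> /T100 /=; lia.
by move=> [] [i /T0 i0 e1] [] [j /T0 j0 e2] [] [k /T0 k0 e3];
  have := @tower_sum i j k i0 j0; have := @tower_sum j k i j0 k0;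
  have := @tower_sum i k j i0 k0; lia.
Qed.

Section RelatorWords.
Variables (X : choiceType) (P : groupType).
Implicit Types phi : X -> P.

Lemma weval_nseq phi n x b :
  weval phi (nseq n (x, b)) = (if b then (phi x)^-1 else phi x) ^+ n.
Proof. by elim: n => [|n IH]; rewrite ?weval_nil // weval_cons IH expgS. Qed.

Lemma weval_flatten phi (I : Type) (F : I -> fword X) (s : seq I) :
  weval phi (flatten [seq F i | i <- s]) = \prod_(i <- s) weval phi (F i).
Proof.
by elim: s => [|i s IH]; rewrite ?weval_nil ?big_nil // big_cons /= weval_cat IH.
Qed.

End RelatorWords.

Definition edge_word (X : choiceType) (x y : X) : fword X :=
  flatten [seq nseq i (x, false) ++ nseq i (y, true) | i <- index_iota 1 101].

Lemma weval_edge_word (X : choiceType) (P : groupType) (phi : X -> P) x y :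
  weval phi (edge_word x y) = edge_relator (phi x) (phi y).
Proof.
rewrite weval_flatten; apply: eq_bigr => i _.
by rewrite weval_cat !weval_nseq expVgn.
Qed.

Definition relator_word (n : nat) : fword bool :=
  flatten [seq nseq i (false, false) ++ nseq (tower n) (true, false) ++
    nseq i (false, true) ++ nseq (tower n) (true, true) | i <- index_iota 1 101].

Lemma relator_wordE n : word_elt (relator_word n) = relator n.
Proof.
rewrite word_elt_weval weval_flatten; apply: eq_bigr => i _.
by rewrite !weval_cat !weval_nseq /comm !expVgn !mulgA.
Qed.

Lemma size_relator_word n :
  (size (relator_word n) <= 100 * (2 * 100 + 2 * tower n))%N.
Proof.
rewrite size_flatten /shape -map_comp sumnE big_map.
apply: (@leq_trans (\sum_(1 <= i < 101) (2 * 100 + 2 * tower n))); last first.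
  by rewrite sum_nat_const_nat subn1.
rewrite big_nat [leqRHS]big_nat; apply: leq_sum => i /andP[_ i101].
by rewrite /= !size_cat !size_nseq; lia.
Qed.

Lemma relator_edge_relator n : relator n = edge_relator F2a (F2a ^ (F2b ^- tower n)).
Proof.
apply: eq_bigr => i _.
by rewrite /comm -conjXg conjgE !invgM invgK !mulgA.
Qed.

Lemma free_lift_relator (P : groupType) (phi : bool -> P) n :
  free_lift phi (relator n) =
  edge_relator (phi false) (phi false ^ (phi true ^- tower n)).
Proof.
have fM := free_liftM phi.
rewrite relator_edge_relator morph_edge_relator // conjgE !fM.
by rewrite !(morph_inv fM) (morph_exp fM) !free_lift_gen conjgE.
Qed.

(** The free group on a and b acts on A * int for any family s of elements of
A indexed by the integers: b lowers the level by one, and a multiplies by s_j at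
level j.  This plays the role of the extension of A by the shift of the
indices.  At level j, the relator w_n acts as
V(s_j, s_(j + tower n)). *)
Section LevelAction.
Variables (A : groupType) (s : int -> A).

Definition level_mul (u : int -> A) : sym (A * int).
Proof.
exists (fun p => (u p.2 * p.1, p.2)) (fun p => ((u p.2)^-1 * p.1, p.2)).
- by case=> g j /=; rewrite mulKg.
- by case=> g j /=; rewrite mulVKg.
Defined.

Definition level_down : sym (A * int).
Proof.
exists (fun p => (p.1, p.2 - 1)%R) (fun p => (p.1, p.2 + 1)%R).
- by case=> g j /=; rewrite subrK.
- by case=> g j /=; rewrite addrK.
Defined.

Definition level_gen (b : bool) := if b then level_down else level_mul s.

Lemma level_mulM u v : level_mul u * level_mul v = level_mul (fun j => u j * v j).
Proof. by apply: sym_eqP => -[g j]; rewrite sym_mulE /= mulgA. Qed.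

Lemma level_mulV u : (level_mul u)^-1 = level_mul (fun j => (u j)^-1).
Proof. by apply: sym_eqP => -[g j]. Qed.

Lemma level_mulX u n : level_mul u ^+ n = level_mul (fun j => u j ^+ n).
Proof.
elim: n => [|n IH]; first by apply: sym_eqP => -[g j] /=; rewrite mul1g.
rewrite expgS IH level_mulM; congr level_mul.
by apply: funext => j; rewrite expgS.
Qed.

Lemma level_edge_relator u v :
  edge_relator (level_mul u) (level_mul v) =
  level_mul (fun j => edge_relator (u j) (v j)).
Proof.
rewrite /edge_relator; elim: (index_iota 1 101) => [|i r IH].
  rewrite big_nil; apply: sym_eqP => -[g j] /=.
  by rewrite big_nil mul1g.
rewrite big_cons IH !level_mulX level_mulV !level_mulM; congr level_mul.
by apply: funext => j; rewrite big_cons.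
Qed.

Lemma level_downX n p : sym_fun (level_down ^+ n) p = (p.1, p.2 - n%:Z)%R.
Proof.
elim: n => [|n IH]; first by rewrite /= subr0; case: p.
by rewrite expgS sym_mulE IH /=; congr (_, _); lia.
Qed.

Lemma level_conj u n :
  level_mul u ^ (level_down ^- n) = level_mul (fun j => u (j + n%:Z)%R).
Proof.
rewrite conjgE invgK; apply: (mulIg (level_down ^+ n)).
rewrite mulgA mulgVK; apply: sym_eqP => -[g j].
by rewrite !sym_mulE !level_downX /= subrK.
Qed.

Lemma level_relator n :
  free_lift level_gen (relator n) =
  level_mul (fun j => edge_relator (s j) (s (j + (tower n)%:Z)%R)).
Proof. by rewrite free_lift_relator /= level_conj level_edge_relator. Qed.

End LevelAction.

(** Rewrites a word in a and b, read from its last letter, as a word in the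
s_j = b^j a b^-j together with the final level, which is minus the exponent
sum of b. *)
Fixpoint level_trace (w : fword bool) : fword int * int :=
  if w is p :: w' then
    let: (v, j) := level_trace w' in
    if p.1 then (v, if p.2 then j + 1 else j - 1)%R else ((j, p.2) :: v, j)
  else ([::], 0%R).

Lemma level_trace_act (A : groupType) (s : int -> A) w :
  sym_fun (weval (level_gen s) w) (1, 0%R) =
  (weval s (level_trace w).1, (level_trace w).2).
Proof.
elim: w => [|[[] b] w IH]; first by rewrite !weval_nil.
  by rewrite weval_cons sym_mulE IH /=; case: (level_trace w) => v j; case: b.
by rewrite weval_cons sym_mulE IH /=; case: (level_trace w) => v j; case: b;
  rewrite /= weval_cons.
Qed.

Lemma level_trace_bound w :
  (`|(level_trace w).2| <= (size w)%:Z)%R /\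
  forall p, p \in (level_trace w).1 -> (`|p.1| <= (size w)%:Z)%R.
Proof.
elim: w => [|[[] b] w] //=; case: (level_trace w) => v j /= [hj hv].
  by split=> [|p /hv]; [case: b|]; lia.
split=> [|p]; first lia.
by rewrite inE => /orP[/eqP -> /=|/hv]; lia.
Qed.

Section IntegerPowers.
Variables (P : groupType) (x : P).

Definition zexpg (z : int) : P :=
  match z with Posz n => x ^+ n | Negz n => x ^- n.+1 end.

Lemma zexpgS z : zexpg (z + 1)%R = zexpg z * x.
Proof.
case: z => [n|[|n]].
- by rewrite -[(Posz n + 1)%R]/(Posz (n + 1)) addn1 /= expgSr.
- by rewrite /= expg1 mulVg.
- have -> : (Negz n.+1 + 1 = Negz n)%R by lia.
  by rewrite /= (expgS x n.+1) invgM mulgVK.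
Qed.

Lemma zexpgP z : zexpg (z - 1)%R = zexpg z * x^-1.
Proof. by rewrite -[in RHS](subrK 1%R z) zexpgS mulgK. Qed.

Lemma zexpgD z n : zexpg (z + n%:Z)%R = zexpg z * x ^+ n.
Proof.
elim: n => [|n IH]; first by rewrite addr0 mulg1.
by rewrite intS [(1 + _)%R]addrC addrA zexpgS IH expgSr mulgA.
Qed.

End IntegerPowers.

Lemma level_trace_weval (P : groupType) (phi : bool -> P) w :
  weval phi w = (zexpg (phi true) (level_trace w).2)^-1 *
    weval (fun j => phi false ^ (zexpg (phi true) j)^-1) (level_trace w).1.
Proof.
elim: w => [|[[] b] w IH]; first by rewrite !weval_nil /= invg1 mulg1.
  rewrite weval_cons IH /=; case: (level_trace w) => v j; case: b => /=.
    by rewrite zexpgS invgM mulgA.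
  by rewrite zexpgP invgM invgK mulgA.
rewrite weval_cons IH /=; case: (level_trace w) => v j /=.
(* A letter moves past the power of b at the cost of a conjugation. *)
have pull g (Z V : P) : g * (Z^-1 * V) = Z^-1 * (g ^ Z^-1 * V).
  by rewrite conjgE invgK !mulgA mulVg mul1g.
by rewrite weval_cons /=; case: b; rewrite -?conjVg pull.
Qed.

Section BowditchRelations.
Variables (T : set nat) (T100 : T `<=` [set n | (100 < n)%N]).

Let A := presented_group (graph_relators (tower_edge T) setT).
Let s : int -> A := presented_gen (graph_relators (tower_edge T) setT).

Let level_trivial g : normal_closure (relator @` T) g ->
  free_lift (level_gen s) g = 1.
Proof.
apply: normal_closure_lift => _ [m Tm <-].
rewrite level_relator; apply: sym_eqP => -[g' j] /=.
by rewrite graph_gen_rel ?mul1g //; exists m.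
Qed.

(** A relation of length at most L is a word in the s_j with |j| <= L.  The
subgraph on these vertices has no edge longer than 2 L, so the relation is a
consequence of the edges of length at most 2 L. *)
Lemma short_relation w L : (size w <= L)%N ->
  normal_closure (relator @` T) (word_elt w) ->
  normal_closure (relator @` (T `&` [set m | (tower m <= 2 * L)%N])) (word_elt w).
Proof.
move=> wL /level_trivial; rewrite free_lift_word => w1.
have := level_trace_act s w; rewrite w1 sym_oneE => -[/esym v1 /esym j0].
have [_ vL] := level_trace_bound w.
pose K := [set x : int | (`|x| <= L%:Z)%R].
have hK : normal_closure (graph_relators (tower_edge T) K) (word_elt (level_trace w).1).
  apply: (@parabolic_embedding _ (tower_edge T) _ _ K setT) => //.
  - exact: tower_edge_triangle_free.
  - exact: tower_edge_irr.
  - by move=> p /vL pw; apply: le_trans pw _; rewrite lez_nat.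
  - exact/presented_eq1.
apply/presented_eq1; set phi := presented_gen _.
rewrite level_trace_weval j0 /= invg1 mul1g -free_lift_word.
apply: lift_graph_relators hK => x y /= xL yL [m Tm yE].
rewrite yE zexpgD invgM conjgM.
rewrite -(@morph_edge_relator _ _ (fun g => g ^ (zexpg (phi true) x)^-1));
  last by move=> u v; rewrite conjMg.
have -> : edge_relator (phi false) (phi false ^ (phi true ^- tower m)) = 1.
  rewrite -free_lift_relator; apply/presented_free_liftE; apply: normal_closure_gen.
  by exists m => //; split=> //=; move: xL yL; rewrite /K yE /=; lia.
by rewrite conj1g.
Qed.

(** If w_n followed from the relators in T, then V(s_0, s_(tower n)) would be
trivial in the group of the graph, hence in the group of the two nonadjacent
vertices 0 and tower n, which is free.  Mapping the first vertex to the shift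
of the integers and the second one to the identity shows that it is not. *)
Lemma relator_independent n : ~ T n -> ~ normal_closure (relator @` T) (relator n).
Proof.
move=> nTn /level_trivial; rewrite level_relator.
move=> /(congr1 (fun u : sym _ => (sym_fun u (1, 0%R)).1)) /=.
rewrite mulg1 add0r -weval_edge_word => /presented_eq1 h.
pose K := [set x : int | x = 0%R \/ x = Posz (tower n)].
have {}h : normal_closure (graph_relators (tower_edge T) K)
    (word_elt (edge_word 0%R (Posz (tower n)))).
  apply: (@parabolic_embedding _ (tower_edge T) _ _ K setT) => //.
  - exact: tower_edge_triangle_free.
  - exact: tower_edge_irr.
  - move=> p /flattenP[_ /mapP[i _ ->]]; rewrite mem_cat.
    by move=> /orP[] /nseqP[-> _]; [left|right].
have addK1 : cancel (fun j : int => j + 1)%R (fun j : int => j - 1)%R.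
  by move=> j; rewrite addrK.
have subK1 : cancel (fun j : int => j - 1)%R (fun j : int => j + 1)%R.
  by move=> j; rewrite subrK.
(* The relator then acts as the shift by 1 + 2 + ... + 100. *)
pose shift : sym int := Sym addK1 subK1.
pose phi (x : int) : sym int := if x == 0%R then shift else 1.
have t0 : Posz (tower n) != 0%R by have := tower_gt n; lia.
have := @lift_graph_relators _ _ _ phi K _ _ h; rewrite free_lift_word weval_edge_word.
rewrite /phi eqxx (negPf t0) => /(_ _)/wrap[].
  move=> x y xK yK [m Tm E]; have mn : m <> n by move=> mn; apply: nTn; rewrite -mn.
  have := tower_gt m; have := @tower_inj m n.
  by case: xK yK E => -> [] -> E; lia.
rewrite /edge_relator => /(congr1 (fun u : sym int => sym_fun u 0%R)).
have -> (r : seq nat) j : sym_fun (\prod_(i <- r) (shift ^+ i * 1 ^- i)) j =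
    (j + (\sum_(i <- r) i)%:Z)%R.
  have shiftX i k : sym_fun (shift ^+ i) k = (k + i%:Z)%R.
    elim: i => [|i IH]; first by rewrite addr0.
    by rewrite expgS sym_mulE IH /= intS -addrA [(i%:Z + _)%R]addrC.
  elim: r => [|i r IH]; first by rewrite !big_nil addr0.
  by rewrite !big_cons expg1n invg1 mulg1 sym_mulE IH shiftX; lia.
by rewrite big_ltn //= sym_oneE; lia.
Qed.

End BowditchRelations.

(** * Transporting fillings along coarse maps *)

(** If p x l is the word read along a path that replaces the edge labelled l
at x, then [walk x w] is read along the path that replaces the edge path
starting at x and labelled by w. *)
Section Walks.
Variables (X : choiceType) (G : groupType) (gen : X -> G).
Variable p : G -> X * bool -> fword X.

Fixpoint walk (x : G) (w : fword X) : fword X :=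
  if w is l :: w' then p x l ++ walk (x * weval gen [:: l]) w' else [::].

Lemma walk_cat x s t : walk x (s ++ t) = walk x s ++ walk (x * weval gen s) t.
Proof.
elim: s x => [|l s IH] x /=; first by rewrite weval_nil mulg1.
by rewrite IH -catA -mulgA -weval_cat.
Qed.

Lemma size_walk c x w : (forall y l, (size (p y l) <= c)%N) ->
  (size (walk x w) <= c * size w)%N.
Proof.
move=> pc; elim: w x => [|l w IH] x //=.
by rewrite size_cat mulnS leq_add.
Qed.

Lemma weval_walk (G' : groupType) (gen' : X -> G') (f : G -> G') x w :
  (forall y l, weval gen' (p y l) = (f y)^-1 * f (y * weval gen [:: l])) ->
  weval gen' (walk x w) = (f x)^-1 * f (x * weval gen w).
Proof.
move=> pf; elim: w x => [|l w IH] x /=; first by rewrite !weval_nil mulg1 mulVg.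
rewrite weval_cat pf IH -mulgA mulVKg; congr (_ * f _).
by rewrite -mulgA -weval_cat.
Qed.

End Walks.

Section CoarseMaps.
Variable X : choiceType.
Implicit Type R : set (free_group X).

Definition word_ball R (n : nat) (x : presented_group R) :=
  exists2 w, (size w <= n)%N & weval (presented_gen R) w = x.

Lemma word_ballS R m n x : (m <= n)%N -> @word_ball R m x -> word_ball n x.
Proof. by move=> mn [w wm wx]; exists w => //; exact: leq_trans mn. Qed.

Definition coarse_lipschitz R R' (c : nat)
    (f : presented_group R -> presented_group R') :=
  forall x l, word_ball c ((f x)^-1 * f (x * weval (presented_gen R) [:: l])).

Definition coarse_retraction R R' (c : nat) (f : presented_group R -> presented_group R')
    (g : presented_group R' -> presented_group R) :=
  forall x, word_ball c (x^-1 * g (f x)).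

Definition short_relators R (r : nat) : set (free_group X) :=
  [set word_elt w | w in
    [set w | (size w <= r)%N /\ weval (presented_gen R) w = 1]].

Lemma short_relator_trivial R r w : (size w <= r)%N ->
  weval (presented_gen R) w = 1 ->
  weval (presented_gen (short_relators R r)) w = 1.
Proof.
by move=> wr w1; apply/presented_eq1; apply: normal_closure_gen; exists w.
Qed.

Section Filling.
Variables (R R' : set (free_group X)) (c : nat).
Variables (f : presented_group R -> presented_group R').
Variables (g : presented_group R' -> presented_group R).
Hypotheses (fL : coarse_lipschitz c f) (gL : coarse_lipschitz c g).
Hypothesis gf : coarse_retraction c f g.
Notation gen := (presented_gen R).
Notation gen' := (presented_gen R').

Section Back.
Variables (r r' : nat) (p : presented_group R' -> X * bool -> fword X).
Hypotheses (cr : (c * r <= r')%N) (cr' : (c * c + 2 * c + 1 <= r')%N).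
Hypothesis p_size : forall y l, (size (p y l) <= c)%N.
Hypothesis p_weval :
  forall y l, weval gen (p y l) = (g y)^-1 * g (y * weval gen' [:: l]).

Notation Q := (presented_group (short_relators R r')).
Notation genQ := (presented_gen (short_relators R r')).
Notation back := (walk gen' p).

(** Backtracking in a path of G' is carried to a loop of length at most 2 c, which
is trivial in Q.  So paths read from y have a value in Q that depends
only on the element of the free group that they represent. *)
Lemma back_free_eq y s t : free_eq s t ->
  weval genQ (back y s) = weval genQ (back y t).
Proof.
move=> st; elim: st y => {s t} [//|s t _ IH y|s t u _ IH1 _ IH2 y|s t x b y].
- by rewrite IH.
- by rewrite IH1 IH2.
pose l := [:: (x, b); (x, ~~ b)].
have l1 (P : groupType) (phi : X -> P) : weval phi l = 1.
  by rewrite -(weval_nil phi); apply: weval_free_eq; exact: (@free_eq_cancel X [::]).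
rewrite -[_ :: _ :: _]/(l ++ t); have l2 : size l = 2%N by [].
clearbody l; rewrite !walk_cat !weval_cat l1 mulg1.
rewrite (@short_relator_trivial _ _ (back _ l)) ?mul1g //.
  by apply: leq_trans (size_walk _ _ _ p_size) _; rewrite l2; lia.
by rewrite (weval_walk _ _ p_weval) l1 mulg1 mulVg.
Qed.

Definition back_elt y (h : free_group X) : Q := weval genQ (back y (repr h)).

Lemma back_elt_word y w : back_elt y (word_elt w) = weval genQ (back y w).
Proof. exact/back_free_eq/repr_pi_free. Qed.

(** The values of paths form a cocycle of the free group with respect to its right
action on G'.  Hence the elements that act trivially and have trivial value
from every base point form a normal subgroup. *)
Lemma back_eltM y h k :
  back_elt y (h * k) = back_elt y h * back_elt (y * free_lift gen' h) k.
Proof.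
rewrite -{1}[h]word_eltK -{1}[k]word_eltK -word_elt_cat back_elt_word.
by rewrite walk_cat weval_cat.
Qed.

Lemma back_elt_normal :
  normal_subgroup [set h | free_lift gen' h = 1 /\ forall y, back_elt y h = 1].
Proof.
have fM := free_liftM gen'.
have back1 y : back_elt y 1 = 1.
  have := back_eltM y 1 1; rewrite (morph_one fM) !mulg1 => E.
  by apply: (mulgI (back_elt y 1)); rewrite -E mulg1.
split=> /= [|h k [h1 hb] [k1 kb]|h [h1 hb]|h k [h1 hb]].
- by split=> //; exact: morph_one.
- split=> [|y]; first by rewrite fM h1 k1 mulg1.
  by rewrite back_eltM h1 mulg1 hb kb mulg1.
- split=> [|y]; first by rewrite morph_inv // h1 invg1.
  by have := back1 y; rewrite -(mulgV h) back_eltM hb h1 mulg1 mul1g.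
split=> [|y]; first by rewrite conjgE !fM h1 mul1g -fM mulVg morph_one.
by rewrite conjgE !back_eltM hb h1 mul1g mulg1 -back_eltM mulVg.
Qed.

Lemma back_trivial y U : normal_closure (short_relators R' r) (word_elt U) ->
  weval genQ (back y U) = 1.
Proof.
move=> hU; rewrite -back_elt_word.
suff [_ ->] : [set h | free_lift gen' h = 1 /\ forall y, back_elt y h = 1]
  (word_elt U) by [].
apply: (sub_normal_closure back_elt_normal _ hU).
move=> _ [w [wr w1] <-] /=; rewrite free_lift_word w1; split=> // z.
rewrite back_elt_word short_relator_trivial //.
  apply: leq_trans (size_walk _ _ _ p_size) (leq_trans _ cr).
  by rewrite leq_mul2l wr orbT.
by rewrite (weval_walk _ _ p_weval) w1 mulg1 mulVg.
Qed.

End Back.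

(** A loop u of G is mapped by f to a loop U of G'.  When U is filled by loops of
length at most r, the map g carries this filling back to a filling of g (f u) by
loops of length at most c r, and the strip between u and g (f u) is filled by one
short loop for each edge of u. *)
Lemma coarse_filling u : weval gen u = 1 ->
  exists U, [/\ (size U <= c * size u)%N, weval gen' U = 1 &
    forall r r', (c * r <= r')%N -> (c * c + 2 * c + 1 <= r')%N ->
      normal_closure (short_relators R' r) (word_elt U) ->
      normal_closure (short_relators R r') (word_elt u)].
Proof.
move=> u1.
have /choice[p hp] : forall yl : presented_group R * (X * bool), exists w,
    (size w <= c)%N /\
    weval gen' w = (f yl.1)^-1 * f (yl.1 * weval gen [:: yl.2]).
  by case=> y l; have [w] := fL y l; exists w.
have /choice[p' hp'] : forall yl : presented_group R' * (X * bool), exists w,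
    (size w <= c)%N /\
    weval gen w = (g yl.1)^-1 * g (yl.1 * weval gen' [:: yl.2]).
  by case=> y l; have [w] := gL y l; exists w.
have /choice[q hq] : forall x, exists w,
    (size w <= c)%N /\ weval gen w = x^-1 * g (f x).
  by move=> x; have [w] := gf x; exists w.
pose forth := walk gen (fun y l => p (y, l)).
pose back := walk gen' (fun y l => p' (y, l)).
have ps y l : (size (p (y, l)) <= c)%N by case: (hp (y, l)).
have pw y l : weval gen' (p (y, l)) = (f y)^-1 * f (y * weval gen [:: l]).
  by case: (hp (y, l)).
have ps' y l : (size (p' (y, l)) <= c)%N by case: (hp' (y, l)).
have pw' y l : weval gen (p' (y, l)) = (g y)^-1 * g (y * weval gen' [:: l]).
  by case: (hp' (y, l)).
exists (forth 1 u); split.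
- exact: (size_walk _ _ _ ps).
- by rewrite (weval_walk _ _ pw) u1 mulg1 mulVg.
move=> r r' cr cr' hU; apply/presented_eq1.
have hback := back_trivial cr cr' ps' pw' (f 1) hU.
pose genQ := presented_gen (short_relators R r').
(* The strip between the path w from x and its image under g after f, with rungs q. *)
have ladder w x : weval genQ w * weval genQ (q (x * weval gen w)) =
    weval genQ (q x) * weval genQ (back (f x) (forth x w)).
  elim: w x => [|l w IH] x; first by rewrite !weval_nil !mulg1 mul1g.
  rewrite -cat1s !weval_cat -mulgA (mulgA x) IH /= {2}/back walk_cat weval_cat !mulgA.
  rewrite pw mulVKg -/back; congr (_ * _).
  (* The loop around one cell of the strip, of length at most 1 + c + c c + c. *)
  pose v := [:: l] ++ q (x * weval gen [:: l]) ++
    winv (back (f x) (p (x, l))) ++ winv (q x).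
  have : weval genQ v = 1.
    apply: short_relator_trivial.
      have sw (w' : fword X) : size (winv w') = size w' by rewrite size_map size_rev.
      rewrite /v !size_cat !sw /=.
      apply: (@leq_trans (1 + (c + (c * c + c)))); last by lia.
      rewrite leq_add2l leq_add ?(hq _).1 // leq_add ?(hq _).1 //.
      by apply: leq_trans (size_walk _ _ _ ps') _; rewrite leq_mul2l ps orbT.
    rewrite /v !weval_cat !weval_winv (weval_walk _ _ pw') pw mulVKg.
    by rewrite !(hq _).2 !invgM !invgK -!mulgA !mulVKg mulVg.
  by rewrite /v !weval_cat !weval_winv mulgA -invgM; exact: divg1_eq.
have := ladder u 1; rewrite u1 mulg1 hback mulg1 -[RHS]mul1g.
exact: mulIg.
Qed.

End Filling.
End CoarseMaps.

(** * Quasi-isometries and the conclusion *)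

Lemma finite_set_bounded (T : choiceType) (A : set T) (phi : T -> nat) :
  finite_set A -> exists c, forall x, A x -> (phi x <= c)%N.
Proof.
move=> /finite_seqP[s ->]; exists (\max_(x <- s) phi x)%N => x xs.
exact: leq_bigmax_seq.
Qed.

Section WordLength.
Variables (G : groupType) (A : set G).

Lemma expressibleM x y m n :
  expressible A x m -> expressible A y n -> expressible A (x * y) (m + n).
Proof.
move=> [s [sm sA ->]] [t [tn tA ->]]; exists (s ++ t); split.
- by rewrite size_cat sm tn.
- by move=> z; rewrite mem_cat => /orP[/sA|/tA].
- by rewrite big_cat.
Qed.

Lemma expressibleV x m : expressible A x m -> expressible A x^-1 m.
Proof.
move=> [s [sm sA ->]]; exists [seq z^-1 | z <- rev s]; split.
- by rewrite size_map size_rev.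
- move=> _ /mapP[z zs ->]; rewrite invgK or_comm; apply: sA.
  by rewrite -mem_rev.
- by rewrite big_map prodgV revK.
Qed.

Hypothesis Agen : generating_set A.

Lemma word_lengthP x :
  expressible A x (word_length A x) /\
  forall m, expressible A x m -> (word_length A x <= m)%N.
Proof.
rewrite /word_length; apply: (@xgetPex _ 0%N [set n | expressible A x n /\
  forall m, expressible A x m -> (n <= m)%N]).
have [n An] := Agen x.
have ex : exists n, `[<expressible A x n>] by exists n; apply/asboolP.
case: (ex_minnP ex) => m /asboolP Am min_m; exists m; split=> // k Ak.
exact/min_m/asboolP.
Qed.

Lemma word_lengthM x y :
  (word_length A (x * y) <= word_length A x + word_length A y)%N.
Proof.
by apply: (word_lengthP _).2; apply: expressibleM; exact: (word_lengthP _).1.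
Qed.

Lemma word_lengthV x : word_length A x^-1 = word_length A x.
Proof.
have le y : (word_length A y^-1 <= word_length A y)%N.
  by apply: (word_lengthP _).2; apply: expressibleV; exact: (word_lengthP _).1.
by apply/eqP; rewrite eqn_leq le /= -{1}(invgK x) le.
Qed.

End WordLength.

Lemma word_ball_word_length (X : choiceType) (R : set (free_group X))
    (A : set (presented_group R)) : finite_generating_set A ->
  exists c, forall x, word_ball (c * word_length A x) x.
Proof.
move=> [Afin Agen].
have /choice[q hq] := @presented_surj X R.
have [c hc] := finite_set_bounded (fun x => size (q x)) Afin.
exists c => x; have [[s [<- sA ->]] _] := word_lengthP Agen x.
elim: s sA => [|z s IH] sA.
  by exists [::]; rewrite ?big_nil ?weval_nil.
have [|w wc ws] := IH; first by move=> y ys; apply: sA; rewrite inE ys orbT.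
have [v vc vz] : word_ball c z.
  case: (sA z (mem_head _ _)) => Az; first by exists (q z); [exact: hc|exact: hq].
  exists (winv (q z^-1)); first by rewrite size_map size_rev; exact: hc.
  by rewrite weval_winv hq invgK.
exists (v ++ w); first by rewrite size_cat /= mulnS leq_add.
by rewrite weval_cat vz ws big_cons.
Qed.

Lemma word_length_letter (X : choiceType) (R : set (free_group X))
    (A : set (presented_group R)) : finite_set [set: X] ->
  exists c, forall l : X * bool,
    (word_length A (weval (presented_gen R) [:: l]) <= c)%N.
Proof.
move=> finX.
have [c hc] := finite_set_bounded
  (fun x => maxn (word_length A (weval (presented_gen R) [:: (x, true)]))
                 (word_length A (weval (presented_gen R) [:: (x, false)]))) finX.
by exists c => -[x b]; apply: leq_trans (hc x I); case: b; rewrite leq_max leqnn ?orbT.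
Qed.

(** One natural number M bounds all the constants; the lower bound of the
quasi-isometry is solved for the distance in the source. *)
Lemma quasi_isometry_nat (R : realType) (G H : groupType) (A : set G) (B : set H) f :
  quasi_isometry (word_dist R A) (word_dist R B) f ->
  exists M : nat,
    [/\ forall x y, (word_length B ((f x)^-1 * f y) <=
          M * word_length A (x^-1 * y) + M)%N,
        forall x y, (word_length A (x^-1 * y) <=
          M * word_length B ((f x)^-1 * f y) + M * M)%N
      & forall z, exists y, (word_length B (z^-1 * f y) <= M)%N].
Proof.
move=> [K [C [K1 C0 fKC fC]]].
have K0 : (0 <= K)%R by apply: le_trans K1.
pose M := (Num.bound K + Num.bound C)%N.
have KM : (K <= M%:R)%R.
  by apply: le_trans (ltW (archi_boundP K0)) _; rewrite ler_nat leq_addr.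
have CM : (C <= M%:R)%R.
  by apply: le_trans (ltW (archi_boundP C0)) _; rewrite ler_nat leq_addl.
exists M; split=> [x y|x y|z].
- have /andP[_] := fKC x y; rewrite /word_dist => h.
  rewrite -(ler_nat R) natrD natrM; apply: le_trans h _.
  by rewrite lerD // ler_wpM2r.
- have /andP[+ _] := fKC x y; rewrite /word_dist lerBlDr => h.
  rewrite -(ler_nat R) natrD !natrM.
  have : (K * (K^-1 * (word_length A (x^-1 * y))%:R) <=
    K * ((word_length B ((f x)^-1 * f y))%:R + C))%R by rewrite ler_wpM2l.
  rewrite mulVKf ?gt_eqF // ?(lt_le_trans ltr01) // => /le_trans; apply.
  by rewrite mulrDr lerD // ?ler_wpM2r // ler_pM.
- have [y hy] := fC z; exists y; rewrite -(ler_nat R).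
  exact: le_trans hy CM.
Qed.

(** A quasi-isometry has a quasi-inverse g, which picks for z a point whose image
is close to z.  Both maps are then coarsely Lipschitz for the lengths of words
in the given generators, since all finite generating sets have comparable
word lengths. *)
Lemma quasi_isometric_coarse (R : realType) (X : choiceType)
    (P P' : set (free_group X)) : finite_set [set: X] ->
  quasi_isometric_groups R (presented_group P) (presented_group P') ->
  exists (c : nat) (f : presented_group P -> presented_group P')
         (g : presented_group P' -> presented_group P),
    [/\ coarse_lipschitz c f, coarse_lipschitz c g,
        coarse_retraction c f g & coarse_retraction c g f].
Proof.
move=> finX [A [B [f [Afg Bfg /quasi_isometry_nat[M [fM Mf /choice[g hg]]]]]]].
have [cA hA] := word_ball_word_length Afg.
have [cB hB] := word_ball_word_length Bfg.
have [a ha] := word_length_letter A finX.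
have [b hb] := word_length_letter B finX.
have gen := Bfg.2.
pose D := (M * (M + b + M) + M * M + (M * a + M) + (M * M + M * M) + M)%N.
exists ((cA + cB) * D)%N, f, g; split.
- move=> x l; apply: word_ballS (hB _); rewrite leq_mul ?leq_addl //.
  apply: leq_trans (fM _ _) _; rewrite mulKg.
  have := ha l; rewrite -(leq_pmul2l (ltn0Sn M)); nia.
- move=> z l; apply: word_ballS (hA _); rewrite leq_mul ?leq_addr //.
  apply: leq_trans (Mf _ _) _.
  set z' := z * _.
  have detour (u v x y : presented_group P') :
      u^-1 * v = ((x^-1 * u)^-1 * (x^-1 * y)) * (y^-1 * v).
    by rewrite invgM invgK -!mulgA !mulVKg.
  rewrite (detour _ _ z z').
  have h : (word_length B (((z^-1 * f (g z))^-1 * (z^-1 * z')) * (z'^-1 * f (g z')))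
      <= M + b + M)%N.
    apply: leq_trans (word_lengthM gen _ _) _; apply: leq_add (hg _).
    apply: leq_trans (word_lengthM gen _ _) _; rewrite word_lengthV //.
    by apply: leq_add (hg _) _; rewrite /z' mulKg.
  have := leq_mul (leqnn M) h; rewrite /D; lia.
- move=> x; apply: word_ballS (hA _); rewrite leq_mul ?leq_addr //.
  apply: leq_trans (Mf _ _) _.
  have := leq_mul (leqnn M) (hg (f x)); rewrite /D; lia.
- move=> z; apply: word_ballS (hB _); rewrite leq_mul ?leq_addl //.
  by apply: leq_trans (hg z) _; rewrite /D; lia.
Qed.

(** The two inequalities that say when n is large enough, for t = tower (n - 1)
and q = 100: twice the length of the image of w_n is smaller than tower (n + 1),
and twice the length of the loops mapped back is smaller than tower n. *)
Lemma filling_scale_lt q c t : (0 < q)%N -> (10 * q * c.+1 <= t)%N ->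
  (2 * (c * (q * (2 * q + 2 * (t * t)))) < t * t * (t * t))%N.
Proof.
move=> q0 tc.
have qt : (q <= t)%N by nia.
have tt : (t <= t * t)%N by nia.
have inner : (q * (2 * q + 2 * (t * t)) <= 4 * q * (t * t))%N by nia.
have cq : (8 * c * q < t * t)%N by nia.
have := leq_mul (leqnn (2 * c)) inner.
have t0 : (0 < t * t)%N by lia.
have : (8 * c * q * (t * t) < t * t * (t * t))%N by rewrite ltn_pmul2r.
lia.
Qed.
Lemma back_scale_lt q c t : (0 < q)%N -> (10 * q * c.+1 <= t)%N ->
  (2 * (c * (q * (2 * q + 2 * t)) + (c * c + 2 * c + 1)) < t * t)%N.
Proof.
move=> q0 tc.
have qt : (q <= t)%N by nia.
have inner : (q * (2 * q + 2 * t) <= 4 * q * t)%N by nia.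
have := leq_mul (leqnn (2 * c)) inner.
have ct : (c.+1 <= t)%N by nia.
have : (10 * q * c.+1 * t <= t * t)%N by rewrite leq_mul2r tc orbT.
have : (c.+1 * c.+1 <= q * c.+1 * t)%N by apply: leq_mul => //; rewrite leq_pmull.
have : (0 < q * t)%N by nia.
lia.
Qed.

(** A relator w_n of G(S) missing from G(S') is mapped to a loop too
short to need the relators above n, and the relators below n are mapped back
to loops too short to need w_n. *)
Lemma coarse_maps_bound (S S' : set nat) (n c : nat)
    (f : bowditch_group S -> bowditch_group S')
    (g : bowditch_group S' -> bowditch_group S) :
  S `<=` [set n | (100 < n)%N] -> S' `<=` [set n | (100 < n)%N] ->
  coarse_lipschitz c f -> coarse_lipschitz c g -> coarse_retraction c f g ->
  S n -> ~ S' n -> (n <= 10 * 100 * c.+1)%N.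
Proof.
move=> hS hS' fL gL gf Sn nS'n; rewrite leqNgt; apply/negP => nc.
have [k nk] : exists k, n = k.+1 by case: n nc {Sn nS'n} => // k _; exists k.
set t := tower k; have tn : tower n = (t * t)%N by rewrite nk towerS.
have tc : (10 * 100 * c.+1 <= t)%N.
  by apply: leq_trans (ltnW (tower_gt k)); move: nc; rewrite nk.
have {nc} := size_relator_word n; rewrite tn; set u := relator_word n => un.
have u1 : weval (presented_gen (relator @` S)) u = 1.
  by apply/presented_eq1; rewrite relator_wordE; apply: normal_closure_gen; exists n.
have [U [Uu U1 hU]] := coarse_filling fL gL gf u1.
have hU' := short_relation hS' (leqnn (size U)) ((presented_eq1 _ _).1 U1).
pose r := (100 * (2 * 100 + 2 * t))%N.
pose r' := (c * r + (c * c + 2 * c + 1))%N.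
have q0 : (0 < 100)%N by [].
have hUr : normal_closure (short_relators (relator @` S') r) (word_elt U).
  apply: normal_closureS hU' => _ [m [S'm /= mU] <-].
  apply: normal_closure_gen; exists (relator_word m); last exact: relator_wordE.
  have mk : (m <= k)%N.
    rewrite leqNgt; apply/negP => km.
    have mn : (n < m)%N.
      by rewrite ltn_neqAle nk km andbT; apply/eqP => km'; apply: nS'n; rewrite nk km'.
    have := leq_tower mn; rewrite towerS tn => tm.
    have := filling_scale_lt q0 tc; rewrite ltnNge => /negP; apply.
    apply: leq_trans tm (leq_trans mU _); rewrite leq_mul2l /=.
    by apply: leq_trans Uu _; rewrite leq_mul2l un orbT.
  split; last first.
    apply/presented_eq1; rewrite relator_wordE; apply: normal_closure_gen.
    by exists m.
  apply: leq_trans (size_relator_word m) _.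
  by rewrite leq_mul2l leq_add2l leq_mul2l leq_tower.
pose T := S `&` [set m | (tower m <= 2 * r')%N].
have hT : normal_closure (relator @` T) (relator n).
  rewrite -relator_wordE; apply: normal_closureS (hU r r' _ _ hUr); last 2 first.
  - exact: leq_addr.
  - exact: leq_addl.
  by move=> _ [w [wr /presented_eq1 w1] <-]; exact: short_relation.
apply: relator_independent hT; first by move=> m [/hS].
move=> [_ /=]; rewrite tn leqNgt => /negP; apply.
exact: back_scale_lt.
Qed.

Lemma infinite_set_nat_gt (A : set nat) b : infinite_set A ->
  exists2 n, A n & (b < n)%N.
Proof.
move=> Ainf; apply: contrapT => h; apply: Ainf.
apply: (@sub_finite_set _ _ `I_b.+1); last exact: finite_II.
by move=> n An /=; rewrite ltnS leqNgt; apply/negP => bn; apply: h; exists n.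
Qed.

Theorem corollary3p6 (R : realType) (S S' : set nat)
    (hS : S `<=` [set n | (100 < n)%N])
    (hS' : S' `<=` [set n | (100 < n)%N])
    (hSS' : infinite_set ((S `\` S') `|` (S' `\` S))) :
  ~ quasi_isometric_groups R (bowditch_group S) (bowditch_group S').
Proof.
move=> /(quasi_isometric_coarse finite_finset)[c [f [g [fL gL gf fg]]]].
have [n nSS' nc] := infinite_set_nat_gt (10 * 100 * c.+1) hSS'.
suff : (n <= 10 * 100 * c.+1)%N by rewrite leqNgt nc.
case: nSS' => -[Sn nSn].
  exact: (coarse_maps_bound hS hS' fL gL gf Sn nSn).
exact: (coarse_maps_bound hS' hS gL fL fg Sn nSn).
Qed.
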